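(* Let $d\ge 3$ and let $G=S\cup\partial S$ be a complete-like graph with $S=K_d$. Let $(X_n)_{n\in\mathbb{N}}$ be a VRRW on $G$ (with arbitrary positive initial local times $(a_i)_{i\in V}$ and arbitrary starting point), and let $z_i(n):=Z_i(n)/n$. Then almost surely: (i) for any $i\in S$, $\lim_{n\to\infty}z_i(n)=1/d$; (ii) for any $j\in\partial S$, $\lim_{n\to\infty}n^{-\frac{1}{d-1}}Z_j(n)$ exists and is non-zero.
   Context: Graphs are locally finite and connected; $V$ is the vertex set of $G$, and $i\sim j$ means that $i$ and $j$ are adjacent. For a subset $S$ of vertices, $\partial S$ is the set of vertices outside $S$ adjacent to some vertex of $S$. A graph $G$ is complete-like if $G=S\cup\partial S$ where (the subgraph on) $S$ is the complete graph $K_d$ on $d\ge 3$ vertices and every $j\in\partial S$ has exactly one neighbor (which lies in $S$); $\partial S=\emptyset$ is allowed. Given a positive sequence $(a_i)_{i\in V}$, a discrete-time process $(X_n)_{n\in\mathbb{N}}$ on $V$ is a vertex-reinforced random walk (VRRW) with starting point $v_0$ and initial local times $(a_i)_{i\in V}$ if $X_0=v_0$ and, for all $n\in\mathbb{N}$, $$\mathbb{P}(X_{n+1}=j\mid\mathcal{F}_n)=\mathbf{1}_{\{j\sim X_n\}}\frac{Z_j(n)}{\sum_{k\sim X_n}Z_k(n)},$$ where $\mathcal{F}_n=\sigma(X_0,\dots,X_n)$ and $Z_i(n):=a_i+\sum_{m=0}^n\mathbf{1}_{\{X_m=i\}}$. *)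

(* Defs.v *)
From HB Require Import structures.
From mathcomp Require Import all_boot all_order all_algebra.
From mathcomp Require Import all_classical all_reals all_analysis.
Set Implicit Arguments.
Unset Strict Implicit.
Unset Printing Implicit Defensive.
Import Order.TTheory GRing.Theory Num.Theory.
Import numFieldNormedType.Exports.
Local Open Scope classical_set_scope.
Local Open Scope ring_scope.

Record graph (V : choiceType) := Graph {
  adj :> rel V ;
  adj_sym : symmetric adj ;
  adj_irr : irreflexive adj }.

Section Graphs.
Variables (V : choiceType) (G : graph V).

Definition neighbors (i : V) : set V := [set j | G i j].

Definition locally_finite : Prop := forall i, finite_set (neighbors i).

Definition connected_graph : Prop :=
  forall i j, exists2 p : seq V, path G i p & last i p = j.

Definition boundary (S : set V) : set V :=
  [set j | ~ S j /\ exists2 i, S i & G i j].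

Definition complete_like (d : nat) (S : set V) : Prop :=
  [/\ (3 <= d)%N,
      (S #= `I_d)%card,
      (forall i j, S i -> S j -> i != j -> G i j),
      S `|` boundary S = setT &
      forall j, boundary S j -> exists2 i, S i & neighbors j = [set i]].

End Graphs.

Section ConditionalProbability.
Context {dO : measure_display} {Omega : measurableType dO} {R : realType}.
Variable P : probability Omega R.

(* [Y] is a version of P(E | F). Here F is a sub-sigma-algebra of the
   measurable sets of [Omega]. *)
Definition is_cond_prob (F : set (set Omega)) (E : set Omega)
    (Y : Omega -> R) : Prop :=
  [/\ (forall B : set R, measurable B -> F (Y @^-1` B)),
      P.-integrable setT (EFin \o Y) &
      forall A, F A -> (\int[P]_(w in A) (Y w)%:E)%E = P (E `&` A)].

End ConditionalProbability.

Section VRRW.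
Context {dO : measure_display} {Omega : measurableType dO} {R : realType}.
Variables (V : choiceType) (G : graph V) (P : probability Omega R).
Variables (v0 : V) (a : V -> R) (X : nat -> Omega -> V).

Definition natural_filtration (n : nat) : set (set Omega) :=
  <<s [set X m @^-1` A | m in [set m | (m <= n)%N] & A in [set: set V]] >>.

Definition local_time (i : V) (n : nat) (w : Omega) : R :=
  a i + \sum_(0 <= m < n.+1) (X m w == i)%:R.

Definition transition (n : nat) (j : V) (w : Omega) : R :=
  (G (X n w) j)%:R *
    (local_time j n w / \sum_(k \in neighbors G (X n w)) local_time k n w).

(* [V] carries the discrete sigma-algebra; the equality X_0 = v0 is only
   required almost surely. *)
Definition is_VRRW : Prop :=
  [/\ (forall n (A : set V), measurable (X n @^-1` A)),
      {ae P, forall w, X 0%N w = v0} &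
      forall n j, is_cond_prob P (natural_filtration n)
        (X n.+1 @^-1` [set j]) (transition n j)].

End VRRW.

(* Main.v *)
Require Import Defs.
From mathcomp Require Import all_boot all_order all_algebra.
From mathcomp Require Import all_classical all_reals all_analysis.
From mathcomp Require Import ring lra.
Set Implicit Arguments.
Unset Strict Implicit.
Unset Printing Implicit Defensive.
Import Order.TTheory GRing.Theory Num.Theory.
Import numFieldNormedType.Exports.
Local Open Scope classical_set_scope.
Local Open Scope ring_scope.

(** The proof rests on one almost sure limit, valid at every vertex, after which
    the argument is deterministic.

    Write Z_v(n) for the local times, N_i(n) for the sum of Z_j(n) over the
    neighbours j of i, T(n) for the sum of all Z_v(n), which is n plus a
    constant, and A_i(n) for the clock of i: the sum of 1 / N_i(t) over the
    times t < n with X_t = i.  When the walk stands at a neighbour i of v, it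
    jumps to v with probability Z_v / N_i.  Hence Z_v exp (- sum of A_i over the
    neighbours i of v) is a nonnegative supermartingale, and so is almost its
    inverse, with Z_v - 1 in place of Z_v once v has been visited.  Both converge, so that almost surely

      ln Z_v(n) - (sum of A_i(n) over the neighbours i of v) converges    ( L )

    for every v ([history_clock_law]).  Supermartingales are taken on the finitely
    branching tree of histories, where Ville's maximal inequality is an induction
    on the horizon ([ville_cylinder]); convergence comes from applying it to
    Dubins' upcrossing potential ([crossing_potential_supermartingale]).

    Now fix a path satisfying ( L ).  Call equivalent two sequences whose difference
    converges.  By ( L ), for a leaf l attached to k and for m, i in S such that
    i, k, m are distinct, ln Z_l is equivalent to A_k while ln Z_m is at least
    A_k + A_i up to a constant, so ln Z_l <= ln T - A_i + C.  The vertices of S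
    other than k carry a positive fraction of T, hence their clocks grow at least
    like a multiple of ln T, and Z_l <= C T^(1 - delta) ([leaf_power]).  Leaves
    are thus negligible: the sum of 1 / T(t) over the visits to leaves converges
    ([leaf_summable]).

    Consequently A_k is equivalent to (sum of 1 / N_k) - ln N_k for k in S
    ([clock_clique]), and ( L ) turns into a closed system of scalar equations for
    the proportions Z_k / T.  By convexity a proportion that is too small is pushed
    up ([visits_clique_linear]), so all of them stay away from 0.  Then
    ln (Z_k / N_k) - ln (Z_m / N_m) is equivalent to a sum of terms
    1 / N_m - 1 / N_k, which pull it back to 0 ([log_odds_cmp]), and therefore all
    proportions tend to 1 / d.  Both pulls are handled by [drift_lower_bound].

    The exponent needs no rate of convergence.  Since Z_k / T has a positive
    limit, ln T is equivalent to ln Z_k, hence by ( L ) to the sum of the A_j over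
    j in S other than k.  Summing over k and solving this linear system, A_k is
    equivalent to ln T / (d - 1); and ln Z_l is equivalent to A_k. *)

(** * Sequences up to a convergent error *)

Section RealSequences.
Context {R : realType}.
Implicit Types (u v w : nat -> R).

Lemma eq_cvgn u v : u =1 v -> cvgn u -> cvgn v.
Proof. by move=> /funext ->. Qed.

(** A record and not an abbreviation, so that applying a lemma about it does not
    unfold the limit into its neighbourhoods. *)
Record asymp u v : Prop := Asymp { asymp_cvgn : cvgn (fun n => u n - v n) }.

Lemma asymp_refl u : asymp u u.
Proof.
by split; apply: eq_cvgn (is_cvg_cst (0 : R)) => n; rewrite subrr.
Qed.

Lemma asymp_sym u v : asymp u v -> asymp v u.
Proof.
by case=> uv; split; apply: eq_cvgn (is_cvgN uv) => n; rewrite fctE opprB.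
Qed.

Lemma asymp_trans v u w : asymp u v -> asymp v w -> asymp u w.
Proof.
by move=> [uv] [vw]; split; apply: eq_cvgn (is_cvgD uv vw) => n; rewrite fctE; ring.
Qed.

Lemma asympD u u' v v' : asymp u v -> asymp u' v' ->
  asymp (fun n => u n + u' n) (fun n => v n + v' n).
Proof.
by move=> [uv] [vw]; split; apply: eq_cvgn (is_cvgD uv vw) => n; rewrite fctE; ring.
Qed.

Lemma asympB u u' v v' : asymp u v -> asymp u' v' ->
  asymp (fun n => u n - u' n) (fun n => v n - v' n).
Proof.
by move=> [uv] [vw]; split; apply: eq_cvgn (is_cvgB uv vw) => n; rewrite !fctE; ring.
Qed.

Lemma asympZ c u v : asymp u v -> asymp (fun n => c * u n) (fun n => c * v n).
Proof.
have cc : cvgn (cst c : nat -> R) by exact: is_cvg_cst.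
by case=> uv; split; apply: eq_cvgn (is_cvgM cc uv) => n; rewrite fctE /= -mulrBr.
Qed.

Lemma cvgn_sum (I : eqType) (r : seq I) (p : pred I) (u : I -> nat -> R) :
  (forall i, i \in r -> p i -> cvgn (u i)) ->
  cvgn (fun n => \sum_(i <- r | p i) u i n).
Proof.
elim: r => [|i r IH] cu.
  by apply: eq_cvgn (is_cvg_cst (0 : R)) => n; rewrite big_nil.
have {}IH : cvgn (fun n => \sum_(i <- r | p i) u i n).
  by apply: IH => j jr; apply: cu; rewrite inE jr orbT.
case pi : (p i); last by apply: eq_cvgn IH => n; rewrite big_cons pi.
have cui : cvgn (u i) by apply: cu => //; rewrite mem_head.
by apply: eq_cvgn (is_cvgD cui IH) => n; rewrite big_cons pi.
Qed.

Lemma asymp_sum (I : eqType) (r : seq I) (p : pred I) (u v : I -> nat -> R) :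
  (forall i, i \in r -> p i -> asymp (u i) (v i)) ->
  asymp (fun n => \sum_(i <- r | p i) u i n) (fun n => \sum_(i <- r | p i) v i n).
Proof.
move=> uv; split; have /cvgn_sum : forall i, i \in r -> p i ->
  cvgn (fun n => u i n - v i n) by move=> i ir pi; case: (uv i ir pi).
by apply: eq_cvgn => n; rewrite sumrB.
Qed.

Lemma cvgn_asympB u v : cvgn v -> asymp (fun n => u n - v n) u.
Proof.
move=> cv; split; apply: eq_cvgn (is_cvgN cv) => n.
by rewrite fctE addrAC subrr add0r.
Qed.

Lemma asymp_bounded u v : asymp u v -> exists C, forall n, `|u n - v n| <= C.
Proof.
move=> [/cvg_seq_bounded [M [_ hM]]]; exists (M + 1) => n.
by apply: (hM (M + 1) _ n) => //; rewrite ltrDl.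
Qed.

Lemma series_ge0_cvgn u C :
  (forall n, 0 <= u n) -> (forall n, series u n <= C) -> cvgn (series u).
Proof.
move=> u0 uC; apply: nondecreasing_is_cvgn.
  by apply/nondecreasing_seqP => n; rewrite seriesSr lerDl.
by exists C => _ [n _ <-].
Qed.

Lemma series_le_scale C u v : (forall n, 0 <= u n) -> (forall n, u n <= C * v n) ->
  cvgn (series v) -> cvgn (series u).
Proof.
move=> u0 uv; move=> cv; apply: (@series_le_cvg _ u (fun n => C * v n)) => //.
  by move=> n; apply: le_trans (uv n).
exact: is_cvg_seriesZ cv.
Qed.

Lemma cvg0_near_le u e : u @ \oo --> (0 : R) -> 0 < e -> \forall n \near \oo, `|u n| <= e.
Proof.
move=> /cvgr0Pnorm_le; exact.
Qed.

Lemma ln_sub_le (x y : R) : 0 < x -> 0 < y -> ln y - ln x <= (y - x) / x.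
Proof.
move=> x0 y0; rewrite -ln_div ?posrE//.
have -> : y / x = 1 + (y - x) / x by field; exact: lt0r_neq0.
by apply: le_ln1Dx; rewrite mulrBl divff ?lt0r_neq0//; have : 0 < y / x by [rewrite divr_gt0]; lra.
Qed.

(** Each increment of ln q differs from d / q by at most the decrement of 1 / q,
    which telescopes. *)
Lemma ln_asymp_series (q d : nat -> R) :
  (forall n, 0 < q n) -> (forall n, 0 <= d n <= 1) ->
  (forall n, q n.+1 = q n + d n.+1) -> (fun n => (q n)^-1) @ \oo --> (0 : R) ->
  asymp (fun n => ln (q n)) (series (fun n => d n / q n)).
Proof.
move=> q0 d01 qS qoo.
have stp n : 0 <= ln (q n.+1) - ln (q n) - d n.+1 / q n.+1 <= (q n)^-1 - (q n.+1)^-1.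
  have qn := q0 n; have qn1 := q0 n.+1; have /andP[d0 d1] := d01 n.+1.
  have e : q n.+1 - q n = d n.+1 by rewrite qS; ring.
  have h1 := ln_sub_le qn qn1; have h2 := ln_sub_le qn1 qn.
  have e' : q n - q n.+1 = - d n.+1 by rewrite qS; ring.
  rewrite e in h1; rewrite e' mulNr in h2.
  have h3 : d n.+1 / q n - d n.+1 / q n.+1 <= (q n)^-1 - (q n.+1)^-1.
    rewrite -mulrBr ler_piMl// subr_ge0 lef_pV2 ?posrE// qS; lra.
  by apply/andP; split; lra.
split; have : cvgn (fun n => ln (q n) - series (fun n => d n / q n) n.+1).
  apply: nondecreasing_is_cvgn.
    apply/nondecreasing_seqP => n; rewrite [X in _ <= _ - X]seriesSr.
    by have /andP[h _] := stp n; lra.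
  exists (ln (q 0%N) - series (fun n => d n / q n) 1%N + (q 0%N)^-1) => _ [n _ <-].
  suff : ln (q n) - series (fun n => d n / q n) n.+1 <=
     ln (q 0%N) - series (fun n => d n / q n) 1%N + (q 0%N)^-1 - (q n)^-1.
    have : 0 < (q n)^-1 by rewrite invr_gt0. lra.
  elim: n => [|n IH]; first lra.
  by rewrite seriesSr; have /andP[_ h] := stp n; lra.
have dq : (fun n => d n / q n) @ \oo --> (0 : R).
  apply: (@squeeze_cvgr _ _ _ _ (cst 0) (fun n => (q n)^-1)) => //; last exact: cvg_cst.
  apply: nearW => n /=; have /andP[d0 d1] := d01 n.
  by rewrite divr_ge0 ?(ltW (q0 n))//= ler_piMl// invr_ge0 ltW.
move=> h; have : cvgn (fun n => d n / q n) by apply/cvg_ex; exists 0.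
move=> /(is_cvgD h) cv; apply: eq_cvgn cv => n.
by rewrite fctE /= seriesSr; ring.
Qed.

(** While x stays below K, the sum s increases by a divergent series, so x cannot
    remain there.  Once x is above K, it can only go below through a single
    step, of size at most C h, and from there s does not decrease; the convergent
    difference x - s accounts for the rest of eta. *)
Lemma drift_lower_bound (x s h : nat -> R) (K C kappa eta : R) :
  asymp x s -> (forall t, 0 <= h t) -> h @ \oo --> (0 : R) -> ~ cvgn (series h) ->
  0 <= C -> 0 < kappa -> 0 < eta ->
  (\forall t \near \oo, - (C * h t) <= s t.+1 - s t) ->
  (\forall t \near \oo, x t <= K -> kappa * h t <= s t.+1 - s t) ->
  \forall n \near \oo, K - eta <= x n.
Proof.
move=> xs h0 h_0 hoo C0 k0 eta0 step drift.
have e4 : 0 < eta / 4 by lra.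
pose e n := x n - s n.
have /cvg_ex[/= l el] : cvgn e := asymp_cvgn xs.
have Ch0 : (fun t => C * h t) @ \oo --> (0 : R) by rewrite -[0](mulr0 C); exact: cvgMr.
have e8 : 0 < eta / 8 by lra.
(* From n1 on, a single downward step and the fluctuations of the error e are small
   fractions of eta. *)
have near1 : \forall t \near \oo, [/\ - (C * h t) <= s t.+1 - s t,
   (x t <= K -> kappa * h t <= s t.+1 - s t), `|C * h t| <= eta / 4 & `|l - e t| <= eta / 8].
  near=> t; split; near: t => //; first exact: (cvg0_near_le Ch0 e4).
  by move: el => /cvgrPdist_le; apply.
have [n1 _ H1] := near1.
have [n2 n12 xn2] : exists2 n2, (n1 <= n2)%N & K < x n2.
  apply: contrapT => abs.
  have xK t : (n1 <= t)%N -> x t <= K.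
    by move=> n1t; rewrite leNgt; apply/negP => Kx; apply: abs; exists t.
  apply: hoo; apply: (@series_ge0_cvgn _ (series h n1 + kappa^-1 * (K - s n1 - l + eta / 8))) => // n.
  have [n1n|n1n] := leqP n1 n; last first.
    have sH : nondecreasing_seq (series h).
      by apply/nondecreasing_seqP => m; rewrite seriesSr lerDl.
    apply: (le_trans (sH _ _ (ltnW n1n))); rewrite lerDl mulr_ge0 ?invr_ge0 ?(ltW k0)//.
    have [_ _ _] := H1 n1 (leqnn _); have := xK _ (leqnn n1).
    by rewrite /e ler_norml => ? /andP[? ?]; lra.
  rewrite -(subnKC n1n); move: (n - n1)%N => m.
  have main : series h (n1 + m)%N - series h n1 <= kappa^-1 * (s (n1 + m)%N - s n1).
    elim: m => [|m IH]; first by rewrite addn0 !subrr mulr0.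
    rewrite addnS seriesSr.
    have [_ d _ _] := H1 _ (leq_addr m n1).
    have /d{}d := xK _ (leq_addr m n1).
    have : h (n1 + m)%N <= kappa^-1 * (s (n1 + m).+1 - s (n1 + m)%N).
      by rewrite ler_pdivlMl.
    move: IH; lra.
  have : kappa^-1 * (s (n1 + m)%N - s n1) <= kappa^-1 * (K - s n1 - l + eta / 8).
    rewrite ler_wpM2l ?invr_ge0 ?(ltW k0)//.
    have [_ _ _] := H1 _ (leq_addr m n1); have := xK _ (leq_addr m n1).
    by rewrite /e ler_norml => ? /andP[? ?]; lra.
  by lra.
exists n2 => // n /= n2n.
(* The lower bound on s is preserved by every step: below K because s does not
   decrease, above K because s = x - e is then too large for one step to undo. *)
suff : K - e n2 - eta / 2 <= s n.
  have [_ _ _] := H1 _ (leq_trans n12 n2n); have [_ _ _] := H1 _ n12.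
  by rewrite /e !ler_norml => /andP[? ?] /andP[? ?]; lra.
rewrite -(subnKC n2n); elim: (n - n2)%N => [|m IH].
  by rewrite addn0 /e; lra.
rewrite addnS.
have n1m : (n1 <= n2 + m)%N by rewrite (leq_trans n12) ?leq_addr.
have [a1 a2 a3 a4] := H1 _ n1m; have [_ _ _ b4] := H1 _ n12.
move: a3 a4 b4; rewrite /e !ler_norml => /andP[? ?] /andP[? ?] /andP[? ?].
rewrite /e in IH *.
have [xK|xK] := leP (x (n2 + m)%N) K.
  have := a2 xK; have : 0 <= kappa * h (n2 + m)%N by rewrite mulr_ge0 ?h0 ?(ltW k0).
  by lra.
by lra.
Unshelve. all: by end_near. Qed.

End RealSequences.

(** * Leaves of a deterministic path *)

(** The graph is the complete graph on [ks], each vertex l of [ls] being attached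
    to the single vertex [par l]. *)
Section Trajectory.
Context {R : realType} {V : choiceType} (G : graph V).
Variables (ks ls : seq V) (par : V -> V) (a : V -> R) (x : nat -> V).
Local Notation vs := (ks ++ ls).
Hypotheses (vs_uniq : uniq vs) (vs_full : forall v, v \in vs).
Hypothesis ks_adj : {in ks &, forall i j, G i j = (i != j)}.
Hypothesis par_ks : {in ls, forall l, par l \in ks}.
Hypothesis ls_adj : {in ls, forall l j, G l j = (j == par l)}.
Hypothesis size_ks : (3 <= size ks)%N.
Hypothesis a_gt0 : forall i, 0 < a i.
Hypothesis x_adj : forall n, G (x n) (x n.+1).

(** The local times of the walk, along a fixed path. *)
Definition visits i n : R := a i + \sum_(0 <= m < n.+1) (x m == i)%:R.
Local Notation Z := visits.
Definition around i n := \sum_(j <- vs | G i j) Z j n.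
Local Notation N := around.
Definition total n := \sum_(j <- vs) Z j n.
Local Notation T := total.
(** The time spent at i, measured in units of 1 / N_i: at each visit to i, the
    expected logarithm of the local time of every neighbour of i increases by about
    1 / N_i. *)
Definition clock i := series (fun t => (x t == i)%:R / N i t).
Local Notation A := clock.

Lemma visitsS i n : Z i n.+1 = Z i n + (x n.+1 == i)%:R.
Proof. by rewrite /visits big_nat_recr//= addrA. Qed.

Lemma visits0 i : Z i 0 = a i + (x 0%N == i)%:R.
Proof. by rewrite /visits big_nat1. Qed.

Lemma visits_ge i n : a i <= Z i n.
Proof. by rewrite lerDl sumr_ge0. Qed.

Lemma visits_gt0 i n : 0 < Z i n.
Proof. exact: lt_le_trans (visits_ge i n). Qed.
Hint Resolve visits_gt0 : core.

Lemma visits_ge0 i n : 0 <= Z i n. Proof. exact: ltW. Qed.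
Hint Resolve visits_ge0 : core.

Lemma ks_uniq : uniq ks.
Proof. by move: vs_uniq; rewrite cat_uniq => /and3P[]. Qed.

Lemma sum_indicator (v : V) (p : pred V) :
  \sum_(k <- vs | p k) (v == k)%:R = (p v)%:R :> R.
Proof.
rewrite big_mkcond (bigD1_seq v)//= eqxx big1 ?addr0 => [|k kv].
  by case: (p v).
by rewrite eq_sym (negbTE kv); case: ifP.
Qed.

Lemma aroundS i n : N i n.+1 = N i n + (G i (x n.+1))%:R.
Proof.
rewrite /around -(sum_indicator (x n.+1)) -big_split/=.
by apply: eq_bigr => j _; rewrite visitsS.
Qed.

Lemma totalS n : T n.+1 = T n + 1.
Proof.
rewrite /total -[1]/(true%:R) -(sum_indicator (x n.+1) xpredT) -big_split/=.
by apply: eq_bigr => j _; rewrite visitsS.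
Qed.

Lemma total0 : 1 <= T 0.
Proof.
rewrite -[leLHS]/(true%:R) -(sum_indicator (x 0%N) xpredT).
by apply: ler_sum => j _; rewrite visits0 lerDr ltW.
Qed.

Lemma totalE n : T n = T 0 + n%:R.
Proof.
elim: n => [|n IH]; first by rewrite addr0.
by rewrite totalS IH -addrA -natr1.
Qed.

Lemma total_ge1 n : 1 <= T n.
Proof. by rewrite totalE; have := total0; have := ler0n R n; lra. Qed.

Lemma total_gt0 n : 0 < T n.
Proof. by have := total_ge1 n; lra. Qed.
Hint Resolve total_gt0 : core.

Lemma totalV_cvg : (fun n => (T n)^-1) @ \oo --> (0 : R).
Proof.
apply: (@squeeze_cvgr _ _ _ _ (cst 0) (@harmonic R)); last exact: cvg_harmonic.
  apply: nearW => n; rewrite invr_ge0 (ltW (total_gt0 n))/= /harmonic.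
  by rewrite lef_pV2 ?posrE// totalE -natr1; have := total0; lra.
exact: cvg_cst.
Qed.

Lemma sum_nbr_clique (F : V -> R) k : k \in ks ->
  \sum_(j <- vs | G k j) F j =
  \sum_(j <- ks | j != k) F j + \sum_(l <- ls | par l == k) F l.
Proof.
move=> kks; rewrite big_cat/=; congr (_ + _).
  rewrite big_seq_cond [RHS]big_seq_cond; apply: eq_bigl => j.
  by case jks : (j \in ks) => //=; rewrite ks_adj// eq_sym.
rewrite big_seq_cond [RHS]big_seq_cond; apply: eq_bigl => j.
by case jls : (j \in ls) => //=; rewrite adj_sym ls_adj// eq_sym.
Qed.

Lemma sum_nbr_leaf (F : V -> R) l : l \in ls ->
  \sum_(j <- vs | G l j) F j = F (par l).
Proof.
move=> lls; rewrite big_mkcond (bigD1_seq (par l))//= ls_adj// eqxx.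
by rewrite big1 ?addr0// => j /negbTE jl; rewrite ls_adj// jl.
Qed.

Lemma around_le_total i n : N i n <= T n.
Proof.
by rewrite /around /total [leRHS](bigID (G i))/= lerDl sumr_ge0.
Qed.

Lemma visits_le_around i j n : G i j -> Z j n <= N i n.
Proof.
move=> Gij; rewrite /around big_mkcond (bigD1_seq j)//= Gij lerDl.
by apply: sumr_ge0 => k _; case: ifP.
Qed.

Lemma visits_le_total j n : Z j n <= T n.
Proof.
by rewrite /total (bigD1_seq j)//= lerDl sumr_ge0.
Qed.

(** Each visit to k, except possibly the current one, is followed by a visit to a
    neighbour of k. *)
Lemma visits_around k n : Z k n <= a k + 1 + N k n.
Proof.
suff h : Z k n <= a k + (x n == k)%:R + N k n.
  by apply: (le_trans h); rewrite lerD2r lerD2l lern1 leq_b1.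
elim: n => [|n IH].
  by rewrite visits0 lerDl sumr_ge0.
have := x_adj n; rewrite visitsS aroundS.
have [-> h|nk h] := eqVneq (x n.+1) k.
  have nk : (x n == k) = false.
    by apply/eqP => e; move: h; rewrite e adj_irr.
  by move: IH; rewrite nk adj_irr /=; lra.
move: IH h; have [-> IH h|_ IH h] := eqVneq (x n) k; first by move: IH; rewrite h /=; lra.
by move: IH; have : (0 : R) <= (G k (x n.+1))%:R by []; move=> /=; lra.
Qed.

Lemma third_vertex i j : exists2 m, m \in ks & (m != i) && (m != j).
Proof.
apply/hasP; apply/negPn/negP => /hasPn h.
have : (size ks <= size [:: i; j])%N.
  apply: uniq_leq_size; first exact: ks_uniq.
  by move=> m /h; rewrite !inE negb_and !negbK.
by rewrite leqNgt size_ks.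
Qed.

Lemma total_split k n : k \in ks ->
  T n = Z k n + N k n + \sum_(l <- ls | par l != k) Z l n.
Proof.
move=> kks; rewrite /around sum_nbr_clique// /total big_cat/=.
rewrite (bigD1_seq k) ?ks_uniq//= [X in _ + X](bigID (fun l => par l == k))/=.
by rewrite !addrA.
Qed.

(** By [visits_around], the visits to k are controlled by N_k, and those to a leaf
    attached to k' <> k by the visits to k', which is a neighbour of k. *)
Lemma total_le_around k : k \in ks -> exists2 C, 0 < C & forall n, T n <= C * N k n.
Proof.
move=> kks.
have [m mks /andP[mk _]] := third_vertex k k.
have Gkm : G k m by rewrite ks_adj// eq_sym.
pose K := a k + 1 + \sum_(l <- ls | par l != k) (a l + 1).
have K0 : 0 <= K.
  rewrite addr_ge0 ?addr_ge0 ?(ltW (a_gt0 _))// sumr_ge0// => l _.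
  by rewrite addr_ge0// ltW.
pose c := (\sum_(l <- ls | par l != k) (1 : R)).
have c0 : 0 <= c by apply: sumr_ge0.
exists (K / a m + 2 + c) => [|n].
  by have : 0 <= K / a m by [rewrite divr_ge0// ltW]; lra.
have N0 : a m <= N k n := le_trans (visits_ge m n) (visits_le_around n Gkm).
have h : \sum_(l <- ls | par l != k) Z l n <=
    \sum_(l <- ls | par l != k) (a l + 1) + c * N k n.
  rewrite /c big_distrl -big_split/= big_seq_cond [leRHS]big_seq_cond.
  apply: ler_sum => l /andP[lls plk]; rewrite mul1r.
  apply: (le_trans (visits_around l n)); rewrite lerD2l.
  rewrite /around sum_nbr_leaf//; apply: visits_le_around.
  by rewrite ks_adj ?par_ks// eq_sym.
have h2 : K <= K / a m * N k n.
  by rewrite mulrAC -mulrA ler_peMr// ler_pdivlMr// mul1r.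
have h3 := visits_around k n.
rewrite (total_split n kks) !mulrDl; move: h h2 h3; rewrite /K; lra.
Qed.

Lemma around_gt0 k n : k \in ks -> 0 < N k n.
Proof.
move=> kks; have [C C0 h] := total_le_around kks.
by have := lt_le_trans (total_gt0 n) (h n); rewrite pmulr_rgt0.
Qed.

Lemma around_gt0_leaf l n : l \in ls -> 0 < N l n.
Proof. by move=> lls; rewrite /around sum_nbr_leaf. Qed.

Lemma around_gt0_all v n : 0 < N v n.
Proof.
have := vs_full v; rewrite mem_cat => /orP[/around_gt0|/around_gt0_leaf]; exact.
Qed.
Hint Resolve around_gt0_all : core.

Lemma clock_ge0 i n : 0 <= A i n.
Proof. by apply: sumr_ge0 => t _; rewrite divr_ge0// ltW. Qed.
Hint Resolve clock_ge0 : core.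

(** Property ( L ), which [history_clock_law] establishes almost surely. *)
Hypothesis clock_law :
  forall v, asymp (fun n => ln (Z v n)) (fun n => \sum_(i <- vs | G v i) A i n).

Lemma clock_law_bound : exists2 C, 0 <= C & forall v n,
  `|ln (Z v n) - \sum_(i <- vs | G v i) A i n| <= C.
Proof.
have [f hf] := choice (fun v => asymp_bounded (clock_law v)).
have f0 v : 0 <= f v := le_trans (normr_ge0 _) (hf v 0%N).
exists (\sum_(v <- vs) f v); first exact: sumr_ge0.
move=> v n; apply: (le_trans (hf v n)).
by rewrite (bigD1_seq v)//= lerDl sumr_ge0.
Qed.

Lemma clock_le_sum (p : pred V) i n : i \in ks -> p i ->
  A i n <= \sum_(j <- ks | p j) A j n.
Proof.
move=> iks pi; rewrite big_mkcond (bigD1_seq i) ?ks_uniq//= pi lerDl.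
by apply: sumr_ge0 => j _; case: ifP.
Qed.

(** The leaf l only follows the clock of its parent, whereas m follows the clocks
    of both the parent and i. *)
Lemma leaf_le_clique : exists2 C, 0 <= C & forall l i m n, l \in ls ->
  i \in ks -> m \in ks -> i != par l -> m != par l -> i != m ->
  ln (Z l n) <= ln (Z m n) - A i n + C.
Proof.
have [C C0 hC] := clock_law_bound; exists (2 * C) => [|l i m n lls iks mks il ml im].
  by rewrite mulr_ge0.
have := hC l n; have := hC m n.
rewrite (sum_nbr_leaf _ lls) (sum_nbr_clique _ mks).
rewrite [X in _ - (X + _)](bigID (pred1 (par l)))/=.
have h0 : A (par l) n <= \sum_(j <- ks | (j != m) && (j == par l)) A j n.
  by apply: clock_le_sum; rewrite ?par_ks// eq_sym ml /=.
have h1 : A i n <= \sum_(j <- ks | (j != m) && (j != par l)) A j n.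
  by apply: clock_le_sum => //; rewrite im il.
have h2 : 0 <= \sum_(l <- ls | par l == m) A l n by exact: sumr_ge0.
by rewrite !ler_norml => /andP[? ?] /andP[? ?]; lra.
Qed.

Lemma ln_total_ge0 n : 0 <= ln (T n).
Proof. by rewrite ln_ge0// total_ge1. Qed.
Hint Resolve ln_total_ge0 : core.

Lemma leaf_le_total : exists2 C, 0 <= C & forall l i n, l \in ls -> i \in ks ->
  i != par l -> ln (Z l n) <= ln (T n) - A i n + C.
Proof.
have [C C0 hC] := leaf_le_clique; exists C => // l i n lls iks il.
have [m mks /andP[mi ml]] := third_vertex i (par l).
apply: (le_trans (hC l i m n _ _ _ _ _ _)) => //; first by rewrite eq_sym.
by rewrite !lerD2r ler_ln ?posrE// visits_le_total.
Qed.

(** N_k consists of the vertices of S other than k and of the leaves at k, and the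
    latter are dominated by any vertex of S other than k. *)
Lemma total_le_others k : k \in ks ->
  exists2 C, 0 < C & forall n, T n <= C * \sum_(m <- ks | m != k) Z m n.
Proof.
move=> kks; have [C C0 hC] := total_le_around kks.
have [B B0 hB] := leaf_le_clique.
have [m mks /andP[mk _]] := third_vertex k k.
have [i iks /andP[ik im]] := third_vertex k m.
pose c := \sum_(l <- ls | par l == k) (1 : R).
have c0 : 0 <= c by exact: sumr_ge0.
have e0 := expR_gt0 B.
exists (C * (1 + c * expR B)) => [|n].
  by rewrite mulr_gt0// ltr_wpDr// mulr_ge0// ltW.
apply: (le_trans (hC n)); rewrite -mulrA ler_pM2l//.
rewrite /around (sum_nbr_clique _ kks) mulrDl mul1r lerD2l.
rewrite /c !mulr_suml big_seq_cond [leRHS]big_seq_cond.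
apply: ler_sum => l /andP[lls /eqP plk]; rewrite mul1r.
have h : Z l n <= expR B * Z m n.
  rewrite -ler_ln ?posrE ?mulr_gt0// lnM ?posrE// expRK.
  have := hB l i m n lls iks mks; rewrite plk => /(_ ik mk im).
  by have := clock_ge0 i n; lra.
apply: (le_trans h); rewrite ler_pM2l//.
rewrite [leRHS]big_mkcond (bigD1_seq m) ?ks_uniq//= mk lerDl.
by apply: sumr_ge0 => j _; case: ifP.
Qed.

Lemma total_double n : T n.+1 <= 2 * T n.
Proof. by rewrite totalS; have := total_ge1 n; lra. Qed.

(** Let Y be the number of visits to the vertices of S other than k.  At each of
    them some A_i increases by at least 1 / T, which dominates the increment
    of ln Y up to a factor, since T = O(Y). *)
Lemma others_clock_ge k : k \in ks -> exists2 c, 0 < c <= 1 & exists2 C, 0 <= C &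
  forall n, c * ln (T n) - C <= \sum_(i <- ks | i != k) A i n.
Proof.
move=> kks; have [C C0 hC] := total_le_others kks.
pose Y n := \sum_(m <- ks | m != k) Z m n; pose D n := \sum_(i <- ks | i != k) A i n.
have Y0 n : 0 < Y n by have := lt_le_trans (total_gt0 n) (hC n); rewrite pmulr_rgt0.
have YT n : Y n <= T n.
  rewrite /total big_cat/= [X in _ <= X + _](bigID (fun m => m != k))/= -addrA lerDl.
  by rewrite addr_ge0// sumr_ge0.
(* The factor 2 pays for replacing T n by T n.+1, and C + 1 makes c at most 1. *)
pose c := (2 * (C + 1))^-1.
have c0 : 0 < c by rewrite invr_gt0; lra.
have c1 : c <= 1 by rewrite invf_le1; lra.
have cC : c * (C * 2) <= 1 by rewrite ler_pdivrMl; lra.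
have step n : c * (ln (Y n.+1) - ln (Y n)) <= D n.+2 - D n.+1.
  have YS : Y n.+1 - Y n = \sum_(m <- ks | m != k) (x n.+1 == m)%:R.
    by rewrite /Y -sumrB; apply: eq_bigr => m _; rewrite visitsS; ring.
  have d0 : 0 <= Y n.+1 - Y n by rewrite YS sumr_ge0.
  have h1 : (Y n.+1 - Y n) / T n.+1 <= D n.+2 - D n.+1.
    rewrite YS /D -sumrB mulr_suml; apply: ler_sum => m _.
    rewrite /clock seriesSr [leRHS]addrC addKr ler_wpM2l//.
    by rewrite lef_pV2 ?posrE// around_le_total.
  have h2 := ln_sub_le (Y0 n) (Y0 n.+1).
  apply: le_trans h1; apply: (le_trans (ler_wpM2l (ltW c0) h2)).
  rewrite mulrCA ler_wpM2l// ler_pdivrMr// ler_pdivlMl//.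
  have : T n.+1 <= C * 2 * Y n by have := total_double n; have : T n <= C * Y n := hC n; lra.
  move=> /(ler_wpM2l (ltW c0)) h; rewrite mulrC; apply: (le_trans h).
  by rewrite mulrA ler_piMl// ltW.
have DY n : c * (ln (Y n) - ln (Y 0)) <= D n.+1.
  elim: n => [|n IH]; first by rewrite subrr mulr0 sumr_ge0.
  by have := step n; lra.
have lnY n : ln (T n) - ln C <= ln (Y n).
  by rewrite lerBlDl -lnM ?posrE// ler_ln ?posrE ?mulr_gt0.
exists c; first by rewrite c0.
exists (`|c * (ln C + ln (Y 0%N) + 1)| + c * ln (T 0)).
  by rewrite addr_ge0// mulr_ge0// ltW.
case=> [|n].
  have : 0 <= D 0%N by exact: sumr_ge0.
  by rewrite -/(D _); have := normr_ge0 (c * (ln C + ln (Y 0%N) + 1)); lra.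
rewrite -/(D _).
have h : ln (T n.+1) <= ln (Y n) + ln C + 1.
  have := ln_sub_le (total_gt0 n) (total_gt0 n.+1).
  have : (T n.+1 - T n) / T n <= 1.
    by rewrite ler_pdivrMr// mul1r; have := total_double n; lra.
  by have := lnY n; lra.
have := ler_wpM2l (ltW c0) h; have := DY n.
have := ler_norm (c * (ln C + ln (Y 0%N) + 1)).
have : 0 <= c * ln (T 0) by rewrite mulr_ge0// ltW.
by lra.
Qed.

(** Average [leaf_le_total] over the d - 1 vertices i other than the parent of l, and
    use [others_clock_ge]: ln Z_l <= (1 - delta) ln T + C.  Adding
    delta ln Z_l <= delta ln T gives the form below. *)
Lemma leaf_power l : l \in ls -> exists2 delta, 0 < delta & exists C,
  forall n, (1 + delta) * ln (Z l n) <= ln (T n) + C.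
Proof.
move=> lls; have [C C0 hC] := leaf_le_total.
have [c /andP[c0 c1] [B B0 hB]] := others_clock_ge (par_ks lls).
pose D := \sum_(i <- ks | i != par l) (1 : R).
have D1 : 1 <= D.
  have [m mks /andP[ml _]] := third_vertex (par l) (par l).
  rewrite /D big_mkcond (bigD1_seq m) ?ks_uniq//= ml lerDl.
  by apply: sumr_ge0 => j _; case: ifP.
have h n : D * ln (Z l n) <= (D - c) * ln (T n) + (D * C + B).
  have : D * ln (Z l n) <= D * (ln (T n) + C) - \sum_(i <- ks | i != par l) A i n.
    rewrite /D !big_distrl -sumrB/= big_seq_cond [leRHS]big_seq_cond.
    by apply: ler_sum => i /andP[iks il]; rewrite !mul1r; have := hC l i n lls iks il; lra.
  by have := hB n; lra.
exists (c / D); first by rewrite divr_gt0//; lra.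
exists ((D * C + B) / D) => n.
have D0 : 0 < D by lra.
rewrite -(ler_pM2l D0); have := h n.
have : c * ln (Z l n) <= c * ln (T n).
  by rewrite ler_wpM2l ?(ltW c0)// ler_ln ?posrE// visits_le_total.
have -> : D * ((1 + c / D) * ln (Z l n)) = D * ln (Z l n) + c * ln (Z l n).
  by field; rewrite lt0r_neq0.
have -> : D * (ln (T n) + (D * C + B) / D) = D * ln (T n) + (D * C + B).
  by field; rewrite lt0r_neq0.
by lra.
Qed.
Lemma ln_total_unbounded (M : R) : \forall n \near \oo, M <= ln (T n).
Proof.
have /cvgr0Pnorm_le := totalV_cvg => /(_ (expR (- M)) (expR_gt0 _)).
apply: filterS => n /=; rewrite ger0_norm ?invr_ge0 ?(ltW (total_gt0 n))// expRN.
by rewrite lef_pV2 ?posrE ?expR_gt0// => h; rewrite -(@expRK _ M) ler_ln ?posrE ?expR_gt0.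
Qed.

Lemma leaf_small l eps : l \in ls -> 0 < eps -> \forall n \near \oo, Z l n <= eps * T n.
Proof.
move=> lls e0; have [d d0 [C hC]] := leaf_power lls.
have := ln_total_unbounded ((C - (1 + d) * ln eps) / d); apply: filterS => n.
rewrite ler_pdivrMr// => h.
rewrite -ler_ln ?posrE ?mulr_gt0// lnM ?posrE//.
have d1 : 0 < 1 + d by lra.
by rewrite -(ler_pM2l d1); have := hC n; lra.
Qed.

(** By [leaf_power], at a visit to l one has 1 / T <= C / Z_l^(1 + delta), which is at
    most a multiple of the decrement of Z_l^(- delta). *)
Lemma leaf_summable l : l \in ls -> cvgn (series (fun t => (x t == l)%:R / T t)).
Proof.
move=> lls; have [d d0 [C hC]] := leaf_power lls.
pose f (z : R) := expR (- d * ln z).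
(* z and z' stand for the local time before and after time t; the former is a l
   at time 0. *)
have step z z' t : 0 < z -> z' = z + (x t == l)%:R -> z' = Z l t ->
    (x t == l)%:R / T t <= expR C / d * (f z - f z').
  move=> z0 zz' zt; case: eqP zz' => _ zz'; last first.
    by move: zz'; rewrite /= addr0 => ->; rewrite subrr mulr0 mul0r.
  have z'0 : 0 < z' by rewrite zt.
  have h1 : (T t)^-1 <= expR C * (f z' / z').
    rewrite -{2}(@lnK _ z') ?posrE// -expRN -!expRD -[leLHS](@lnK _ (T t)^-1) ?posrE ?invr_gt0//.
    by rewrite ler_expR lnV ?posrE//; have := hC t; rewrite -zt; lra.
  have h2 : d * (f z' / z') <= f z - f z'.
    have -> : f z = f z' * expR (d * (ln z' - ln z)) by rewrite -expRD; congr expR; ring.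
    have h3 := expR_ge1Dx (d * (ln z' - ln z)).
    have h4 : d / z' <= d * (ln z' - ln z).
      rewrite ler_pM2l//; have := ln_sub_le z'0 z0.
      have -> : (z - z') / z' = - z'^-1 by rewrite zz' /=; field; rewrite -[1]/(true%:R) -zz' lt0r_neq0.
      by lra.
    have -> : f z' * expR (d * (ln z' - ln z)) - f z' = f z' * (expR (d * (ln z' - ln z)) - 1) by ring.
    rewrite mulrCA ler_pM2l ?expR_gt0//; lra.
  rewrite mul1r; apply: (le_trans h1); rewrite -mulrA ler_pM2l ?expR_gt0//.
  by rewrite ler_pdivlMl.
apply: (@series_ge0_cvgn _ _ (expR C / d * f (a l))) => [n|n].
  by rewrite divr_ge0// ltW.
have K0 : 0 <= expR C / d by rewrite divr_ge0 ?expR_ge0 ?ltW.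
suff h m : series (fun t => (x t == l)%:R / T t) m.+1 <= expR C / d * (f (a l) - f (Z l m)).
  case: n => [|n]; first by rewrite /series/= big_geq// mulr_ge0 ?expR_ge0.
  by apply: (le_trans (h n)); rewrite ler_wpM2l// lerBlDr lerDl expR_ge0.
elim: m => [|m IH].
  rewrite seriesSr /series/= big_geq// add0r.
  by apply: step => //; rewrite visits0.
rewrite seriesSr.
have := step (Z l m) (Z l m.+1) m.+1 (visits_gt0 _ _) (visitsS _ _) erefl.
by lra.
Qed.

(** * Proportions of time spent in the clique *)

Lemma ln_total_asymp : asymp (fun n => ln (T n)) (series (fun t => 1 / T t)).
Proof.
apply: (@ln_asymp_series _ T (cst 1)) => //=.
- by move=> n; rewrite ler01 lexx.
- by move=> n; rewrite totalS.
- exact: totalV_cvg.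
Qed.

Lemma total_harmonic_cvg0 : (fun t => 1 / T t) @ \oo --> (0 : R).
Proof.
apply: cvg_trans totalV_cvg; apply: near_eq_cvg; apply: nearW => n.
by rewrite div1r.
Qed.

Lemma total_harmonic_dvg : ~ cvgn (series (fun t => 1 / T t)).
Proof.
move=> cs; have [B hB] := asymp_bounded ln_total_asymp.
have [B' [_ hB']] := cvg_seq_bounded cs.
have [n _ hn] := ln_total_unbounded (B + (B' + 1) + 1).
have := hn n (leqnn n); have := hB n; have := hB' (B' + 1) _ n I.
rewrite ltrDl => /(_ ltr01) /ler_normlP[_ h1] /ler_normlP[_ h2] /= h3.
by lra.
Qed.

(** At each time the walk is at k, at a neighbour of k, or at a leaf not attached
    to k.  Weighted by 1 / N_k, the first times sum to A_k, the second ones to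
    ln N_k up to a convergent error, and the last ones to a convergent series. *)
Lemma clock_clique k : k \in ks ->
  asymp (A k) (fun n => series (fun t => 1 / N k t) n - ln (N k n)).
Proof.
move=> kks; have [C C0 hC] := total_le_around kks.
have hV n : (N k n)^-1 <= C * (T n)^-1.
  by rewrite ler_pdivlMr// ler_pdivrMl// mulrC.
have NV0 : (fun n => (N k n)^-1) @ \oo --> (0 : R).
  apply: (@squeeze_cvgr _ _ _ _ (cst 0) (fun n => C * (T n)^-1)).
  - by apply: nearW => n; rewrite hV invr_ge0/= ltW.
  - exact: cvg_cst.
  - by rewrite -[0](mulr0 C); apply: cvgMr; exact: totalV_cvg.
have lnN : asymp (fun n => ln (N k n)) (series (fun t => (G k (x t))%:R / N k t)).
  apply: ln_asymp_series => // n; first by rewrite ler0n lern1 leq_b1.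
  by rewrite aroundS.
pose o t := \sum_(l <- ls | par l != k) (x t == l)%:R / N k t : R.
have so : cvgn (series o).
  pose o' t := \sum_(l <- ls | par l != k) (x t == l)%:R / T t.
  have : cvgn (series o').
    have /cvgn_sum : forall l, l \in ls -> par l != k ->
        cvgn (series (fun t => (x t == l)%:R / T t)) by move=> l /leaf_summable.
    by apply: eq_cvgn => n; rewrite /series/= exchange_big.
  apply: (@series_le_scale _ C) => t.
    by apply: sumr_ge0 => l _; rewrite divr_ge0// ltW.
  rewrite big_distrr/=; apply: ler_sum => l _.
  by rewrite mulrCA ler_wpM2l.
have split t : (x t == k)%:R / N k t = 1 / N k t - (G k (x t))%:R / N k t - o t.
  rewrite /o -mulr_suml -!mulrBl; congr (_ / _).
  have := sum_indicator (x t) predT; rewrite big_cat/=.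
  rewrite (bigD1_seq k) ?ks_uniq//= [X in _ + X](bigID (fun l => par l == k))/=.
  have := sum_indicator (x t) (G k); rewrite sum_nbr_clique//.
  by lra.
have -> : A k = fun n => series (fun t => 1 / N k t) n -
    series (fun t => (G k (x t))%:R / N k t) n - series o n.
  apply/funext => n; rewrite /clock/= /series/= -!sumrB.
  by apply: eq_bigr => t _; rewrite split.
apply: asymp_trans (cvgn_asympB _ so) _.
exact: asympB (asymp_refl _) (asymp_sym lnN).
Qed.
Local Notation d := ((size ks)%:R : R).

Lemma sum_others_const (c : R) k : k \in ks -> \sum_(j <- ks | j != k) c = (d - 1) * c.
Proof.
move=> kks; have : \sum_(j <- ks) c = d * c.
  by rewrite big_const_seq count_predT iter_addr_0 mulr_natl.
by rewrite (bigD1_seq k) ?ks_uniq//=; lra.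
Qed.

Lemma leaves_small eps : 0 < eps ->
  \forall n \near \oo, \sum_(l <- ls) Z l n <= eps * T n.
Proof.
suff gen s e : {subset s <= ls} -> 0 < e ->
    \forall n \near \oo, \sum_(l <- s) Z l n <= e * T n by exact: gen.
elim: s e => [|l s IH] {}eps sls e0.
  by apply: nearW => n; rewrite big_nil mulr_ge0 ?ltW.
have e2 : 0 < eps / 2 by lra.
have sls' : forall m, m \in s -> m \in ls by move=> m ms; apply: sls; rewrite inE ms orbT.
have := leaf_small (sls l (mem_head _ _)) e2; have := IH _ sls' e2.
by apply: filterS2 => n; rewrite big_cons; lra.
Qed.

(** The quantity f = ln (Z_k / T) + sum over j <> k of ln (N_j / T) is within a bounded
    distance of ln (Z_k / T), and is equivalent to the sum of
    (sum over j <> k of 1 / N_j) - d / T, plus a nondecreasing term due to the leaves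
    at k.  When Z_k / T is small the N_j, for j <> k, add up to about (d - 2) T, so by
    convexity the sum of their inverses is at least (d - 1)^2 / ((d - 2) T), which
    exceeds d / T because (d - 1)^2 = d (d - 2) + 1.  Hence f cannot tend to - oo. *)
Lemma visits_clique_linear k : k \in ks ->
  exists2 c, 0 < c & \forall n \near \oo, c * T n <= Z k n.
Proof.
move=> kks.
pose D2 : R := d - 2; have D21 : 1 <= D2.
  by have : (3%:R <= d) by [rewrite ler_nat]; rewrite /D2; lra.
have D20 : 0 < D2 by lra.
pose f n := ln (Z k n) + \sum_(j <- ks | j != k) ln (N j n) - d * ln (T n).
pose s n := \sum_(j <- ks | j != k) series (fun t => 1 / N j t) n +
  \sum_(l <- ls | par l == k) A l n - d * series (fun t => 1 / T t) n.
have fs : asymp f s.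
  apply: asympB; last exact: asympZ ln_total_asymp.
  have h1 := clock_law k.
  have h2 : asymp (fun n => \sum_(j <- ks | j != k) ln (N j n)) (fun n =>
     \sum_(j <- ks | j != k) series (fun t => 1 / N j t) n - \sum_(j <- ks | j != k) A j n).
    split; have /asymp_cvgn : asymp (fun n => \sum_(j <- ks | j != k) A j n)
      (fun n => \sum_(j <- ks | j != k) (series (fun t => 1 / N j t) n - ln (N j n))).
      by apply: asymp_sum => j jks _; exact: clock_clique.
    by apply: eq_cvgn => n; rewrite sumrB; ring.
  split; apply: eq_cvgn (asymp_cvgn (asympD h1 h2)) => n.
  by rewrite (sum_nbr_clique _ kks); ring.
have [C0 hC0] : exists C, forall j, j \in ks -> forall n, ln (T n) - ln (N j n) <= C.
  suff : forall j, exists C, j \in ks -> forall n, ln (T n) - ln (N j n) <= C.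
    move=> /choice[F hF]; exists (\sum_(j <- ks) `|F j|) => j jks n.
    apply: (le_trans (hF j jks n)); apply: (le_trans (ler_norm _)).
    by rewrite (bigD1_seq j) ?ks_uniq//= lerDl sumr_ge0.
  move=> j; have [jks|] := boolP (j \in ks); last by exists 0.
  have [C C0 hC] := total_le_around jks; exists (ln C) => _ n.
  by rewrite lerBlDr -lnM ?posrE// ler_ln ?posrE ?mulr_gt0.
(* Small enough for the errors Z_k / T and (leaves) / T, each at most eta, to
   consume no more than half of the gap 1 / D2 between (d - 1)^2 / (d - 2) and d. *)
pose eta := (16 * D2)^-1 : R.
have eta0 : 0 < eta by rewrite invr_gt0; lra.
pose M := (d - 1) * C0.
have fU n : f n <= ln (Z k n) - ln (T n).
  rewrite /f; have : \sum_(j <- ks | j != k) ln (N j n) <= (d - 1) * ln (T n).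
    rewrite -(sum_others_const _ kks); apply: ler_sum => j _.
    by rewrite ler_ln ?posrE// around_le_total.
  by lra.
have fL n : ln (Z k n) - ln (T n) - M <= f n.
  rewrite /f; have : \sum_(j <- ks | j != k) (ln (T n) - C0) <= \sum_(j <- ks | j != k) ln (N j n).
    rewrite big_seq_cond [leRHS]big_seq_cond; apply: ler_sum => j /andP[jks _].
    by have := hC0 j jks n; lra.
  by rewrite sum_others_const// /M; lra.
pose K := ln eta - M.
have smalls := leaves_small eta0.
have stp t : \sum_(j <- ks | j != k) 1 / N j t - d / T t <= s t.+1 - s t.
  rewrite /s.
  have -> : \sum_(j <- ks | j != k) series (fun t => 1 / N j t) t.+1 =
     \sum_(j <- ks | j != k) series (fun t => 1 / N j t) t + \sum_(j <- ks | j != k) 1 / N j t.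
    by rewrite -big_split; apply: eq_bigr => j _; rewrite /= seriesSr.
  have : \sum_(l <- ls | par l == k) A l t <= \sum_(l <- ls | par l == k) A l t.+1.
    by apply: ler_sum => l _; rewrite /clock seriesSr lerDl divr_ge0// ltW.
  by rewrite [series (fun t => 1 / T t) t.+1]seriesSr; lra.
have near1 : \forall n \near \oo, K - 1 <= f n.
  have d20 : 0 < (2 * D2)^-1 by rewrite invr_gt0; lra.
  apply: (@drift_lower_bound _ f s (fun t => 1 / T t) K d ((2 * D2)^-1) 1) => //.
  - by move=> t; rewrite divr_ge0// ltW.
  - exact: total_harmonic_cvg0.
  - exact: total_harmonic_dvg.
  - apply: nearW => t; apply: le_trans (stp t).
    rewrite -[leRHS]addr0 -mulNr.
    have : 0 <= \sum_(j <- ks | j != k) 1 / N j t.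
      by apply: sumr_ge0 => j _; rewrite divr_ge0// ltW.
    by rewrite mul1r mulNr; lra.
  - move: smalls; apply: filterS => t Lt fK; apply: le_trans (stp t).
    have Zk : Z k t <= eta * T t.
      rewrite -ler_ln ?posrE ?mulr_gt0// lnM ?posrE//.
      by have := fL t; rewrite /K in fK; lra.
    (* y |-> 2 p - p^2 y is the tangent to y |-> 1 / y at 1 / p, the value of the
       N_j / T when they are all equal and Z_k and the leaves are negligible. *)
    pose p := (D2 + 1) / D2.
    have pD : p * D2 = D2 + 1 by rewrite /p divfK// lt0r_neq0.
    have p0 : 0 < p by rewrite divr_gt0//; lra.
    have p2 : p <= 2 by rewrite ler_pdivrMr//; lra.
    have tangent j : (2 * p - p ^+ 2 * (N j t / T t)) / T t <= 1 / N j t.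
      have y0 : 0 < N j t / T t by rewrite divr_gt0.
      have -> : 1 / N j t = (N j t / T t)^-1 / T t by field; rewrite !lt0r_neq0.
      rewrite ler_pM2r ?invr_gt0// -[leRHS]div1r ler_pdivlMr//.
      by have := sqr_ge0 (1 - p * (N j t / T t)); rewrite !expr2; lra.
    have sumN : \sum_(j <- ks | j != k) N j t <= (D2 + 2 * eta) * T t.
      have : \sum_(j <- ks | j != k) N j t <= \sum_(j <- ks | j != k) (T t - Z j t).
        rewrite big_seq_cond [leRHS]big_seq_cond; apply: ler_sum => j /andP[jks _].
        rewrite (total_split t jks).
        have : 0 <= \sum_(l <- ls | par l != j) Z l t by exact: sumr_ge0.
        by lra.
      rewrite sumrB sum_others_const//.
      have : T t = Z k t + \sum_(j <- ks | j != k) Z j t + \sum_(l <- ls) Z l t.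
        by rewrite /total big_cat/= (bigD1_seq k) ?ks_uniq.
      by rewrite /D2; lra.
    have h : \sum_(j <- ks | j != k) (2 * p - p ^+ 2 * (N j t / T t)) / T t <=
        \sum_(j <- ks | j != k) 1 / N j t by apply: ler_sum.
    have e1 : \sum_(j <- ks | j != k) (2 * p - p ^+ 2 * (N j t / T t)) / T t =
        ((D2 + 1) * (2 * p) - p ^+ 2 * (\sum_(j <- ks | j != k) N j t / T t)) / T t.
      rewrite -mulr_suml sumrB sum_others_const// -mulr_sumr -mulr_suml /D2.
      by congr ((_ * _ - _) / _); ring.
    have h2 : \sum_(j <- ks | j != k) N j t / T t <= D2 + 2 * eta.
      by rewrite -mulr_suml ler_pdivrMr.
    have h3 : p ^+ 2 * (\sum_(j <- ks | j != k) N j t / T t) <= p ^+ 2 * (D2 + 2 * eta).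
      by rewrite ler_wpM2l// sqr_ge0.
    have h4 : p ^+ 2 * eta <= 4 * eta.
      by rewrite ler_wpM2r// ?(ltW eta0)// expr2; have := ler_pM (ltW p0) (ltW p0) p2 p2; lra.
    have h5 : 8 * eta = (2 * D2)^-1 by rewrite /eta; field; rewrite lt0r_neq0.
    have h6 : p * (D2 + 1) = D2 + 2 + 2 * (2 * D2)^-1.
      by rewrite /p; field; rewrite lt0r_neq0.
    have h7 : p ^+ 2 * D2 = p * (D2 + 1) by rewrite -pD; ring.
    rewrite mul1r; apply: le_trans (lerB h (lexx _)); rewrite e1 -mulrBl.
    rewrite ler_pM2r ?invr_gt0//.
    have -> : d = D2 + 2 by rewrite /D2; ring.
    by lra.
exists (expR (K - 1)); first exact: expR_gt0.
move: near1; apply: filterS => n h.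
rewrite -ler_ln ?posrE ?mulr_gt0 ?expR_gt0// lnM ?posrE ?expR_gt0// expRK.
by have := fU n; lra.
Qed.
Lemma total_le_visits k : k \in ks -> exists2 C, 0 < C & forall n, T n <= C * Z k n.
Proof.
move=> kks; have [c c0 [n0 _ h]] := visits_clique_linear kks.
exists (c^-1 + T n0 / a k) => [|n].
  by rewrite addr_gt0 ?invr_gt0// divr_gt0.
rewrite mulrDl; have [n0n|nn0] := leqP n0 n.
  apply: (@le_trans _ _ (c^-1 * Z k n)); first by rewrite ler_pdivlMl// h.
  by rewrite lerDl mulr_ge0// divr_ge0// ltW.
apply: (@le_trans _ _ (T n0 / a k * Z k n)); last first.
  by rewrite lerDr mulr_ge0// invr_ge0 ltW.
have TT : T n <= T n0 by rewrite (totalE n) (totalE n0) lerD2l ler_nat ltnW.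
apply: (le_trans TT); rewrite -mulrA ler_peMr ?(ltW (total_gt0 _))//.
by rewrite mulrC ler_pdivlMr// mul1r visits_ge.
Qed.

Lemma leaf_clock_cvg l : l \in ls -> cvgn (A l).
Proof.
move=> lls; have [C C0 hC] := total_le_visits (par_ks lls).
apply: series_le_scale (leaf_summable lls) => t.
  by rewrite divr_ge0// ltW.
rewrite /around (sum_nbr_leaf _ lls).
by rewrite mulrCA ler_wpM2l// ler_pdivlMr// ler_pdivrMl// mulrC.
Qed.

Lemma ln_visits_clique k : k \in ks ->
  asymp (fun n => ln (Z k n)) (fun n => \sum_(i <- ks) A i n - A k n).
Proof.
move=> kks; have cB : cvgn (fun n => \sum_(l <- ls | par l == k) A l n).
  by apply: cvgn_sum => l lls _; exact: leaf_clock_cvg.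
apply: asymp_trans (clock_law k) _.
split; apply: eq_cvgn cB => n; rewrite (sum_nbr_clique _ kks).
by rewrite [X in _ - (X - _)](bigD1_seq k) ?ks_uniq//=; ring.
Qed.

Local Notation U k n := (ln (Z k n) - ln (N k n)).

Lemma total_ratio k n : k \in ks ->
  T n / N k n = 1 + Z k n / N k n + (\sum_(l <- ls | par l != k) Z l n) / N k n.
Proof.
move=> kks; rewrite [in LHS](total_split n kks).
move: (Z k n) (N k n) (lt0r_neq0 (around_gt0_all k n)) => z y y0.
by field.
Qed.

(** Let r_k = Z_k / N_k.  Up to leaves T / N_k = 1 + r_k, so the drift 1 / N_m - 1 / N_k
    of ln r_k - ln r_m is about (r_m - r_k) / T, which has the opposite sign.  It is not
    small as long as the two logarithms differ by at least eta, because r_m is at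
    least Z_m / T. *)
Lemma log_odds_cmp eta k m : k \in ks -> m \in ks -> 0 < eta ->
  \forall n \near \oo, - (2 * eta) <= U k n - U m n.
Proof.
move=> kks mks eta0.
pose s n := series (fun t => 1 / N m t) n - series (fun t => 1 / N k t) n.
have xs : asymp (fun n => U k n - U m n) s.
  have h i : i \in ks -> asymp (fun n => U i n)
      (fun n => \sum_(j <- ks) A j n - series (fun t => 1 / N i t) n).
    move=> iks; split.
    apply: eq_cvgn (is_cvgB (asymp_cvgn (ln_visits_clique iks)) (asymp_cvgn (clock_clique iks))) => n.
    by rewrite !fctE; ring.
  split; apply: eq_cvgn (asymp_cvgn (asympB (h k kks) (h m mks))) => n.
  by rewrite /s; ring.
have [C C0 hC] := total_le_around kks.
have [c c0 hc] := visits_clique_linear mks.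
pose q := expR (- eta).
have lnq : ln q = - eta by exact: expRK.
have q1 : q < 1 by rewrite expR_lt1; lra.
have cq0 : 0 < c * (1 - q) / 2 by rewrite divr_gt0// mulr_gt0//; lra.
have NV t : (N k t)^-1 <= C / T t by rewrite ler_pdivlMr// ler_pdivrMl// mulrC.
have stp t : s t.+1 - s t = 1 / N m t - 1 / N k t by rewrite /s !seriesSr; ring.
have -> : - (2 * eta) = - eta - eta by ring.
apply: (@drift_lower_bound _ _ s (fun t => 1 / T t) (- eta) C (c * (1 - q) / 2) eta xs) => //.
- by move=> t; rewrite divr_ge0// ltW.
- exact: total_harmonic_cvg0.
- exact: total_harmonic_dvg.
- exact: ltW.
- apply: nearW => t; rewrite stp; have := NV t.
  have : 0 < (N m t)^-1 by rewrite invr_gt0.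
  by rewrite !div1r; lra.
- have eps0 : 0 < c * (1 - q) / 2 / C by rewrite divr_gt0.
  move: hc (leaves_small eps0); apply: filterS2 => t hc L xK.
  rewrite stp.
  have rk : Z k t / N k t <= q * (Z m t / N m t).
    rewrite -ler_ln ?posrE ?mulr_gt0 ?invr_gt0 ?expR_gt0//.
    rewrite [leRHS]lnM ?posrE ?divr_gt0 ?expR_gt0// lnq !ln_div ?posrE//.
    by move: xK; lra.
  have rm : c <= Z m t / N m t.
    rewrite ler_pdivlMr//; apply: le_trans hc; rewrite ler_pM2l//.
    exact: around_le_total.
  have Om : 1 + Z m t / N m t <= T t / N m t.
    rewrite (total_ratio t mks) lerDl.
    by rewrite divr_ge0 ?sumr_ge0// ltW.
  have Ok : T t / N k t <= 1 + Z k t / N k t + c * (1 - q) / 2.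
    rewrite (total_ratio t kks) lerD2l.
    have h1 : \sum_(l <- ls | par l != k) Z l t <= \sum_(l <- ls) Z l t.
      by rewrite [leRHS](bigID (fun l => par l != k))/= lerDl sumr_ge0.
    apply: (@le_trans _ _ ((c * (1 - q) / 2 / C * T t) * (C / T t))).
      apply: ler_pM => //; [exact: sumr_ge0|by rewrite invr_ge0 ltW|exact: le_trans L].
    by rewrite le_eqVlt; apply/orP; left; apply/eqP; field; rewrite !lt0r_neq0.
  have -> : 1 / N m t - 1 / N k t = (T t / N m t - T t / N k t) * (1 / T t).
    by field; rewrite !lt0r_neq0.
  rewrite ler_pM2r ?divr_gt0//.
  have h2 : c * (1 - q) <= Z m t / N m t * (1 - q) by rewrite ler_wpM2r//; lra.
  by lra.
Qed.

(** Up to leaves Z_k N_m - Z_m N_k = Z_k (T - Z_m) - Z_m (T - Z_k) = (Z_k - Z_m) T. *)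
Lemma visits_cmp eps k m : k \in ks -> m \in ks -> 0 < eps ->
  \forall n \near \oo, Z k n - Z m n <= eps * T n.
Proof.
move=> kks mks eps0.
have e2 : 0 < eps / 2 by lra.
have h0 : 0 < ln (1 + eps / 2) / 2 by rewrite divr_gt0// ln_gt0//; lra.
have := log_odds_cmp mks kks h0; have := leaves_small e2.
apply: filterS2 => n L h.
have {h} r : Z k n * N m n <= (1 + eps / 2) * (Z m n * N k n).
  have e1 : 0 < 1 + eps / 2 by lra.
  rewrite -ler_ln ?posrE ?mulr_gt0// !lnM ?posrE ?mulr_gt0//; lra.
have Nm : T n - Z m n - eps / 2 * T n <= N m n.
  have : \sum_(l <- ls | par l != m) Z l n <= \sum_(l <- ls) Z l n.
    by rewrite [leRHS](bigID (fun l => par l != m))/= lerDl sumr_ge0.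
  by rewrite {1}(total_split n mks); lra.
have Nk : N k n <= T n - Z k n.
  have : 0 <= \sum_(l <- ls | par l != k) Z l n by exact: sumr_ge0.
  by rewrite (total_split n kks); lra.
have h1 : Z k n * (T n - Z m n - eps / 2 * T n) <= Z k n * N m n by rewrite ler_wpM2l.
have h2 : Z m n * N k n <= Z m n * (T n - Z k n) by rewrite ler_wpM2l.
have h3 : Z m n * N k n <= T n * T n.
  by rewrite ler_pM ?(ltW (around_gt0_all _ _))// ?visits_le_total// around_le_total.
have h4 : Z k n * T n <= T n * T n by rewrite ler_pM2r// visits_le_total.
rewrite -(ler_pM2r (total_gt0 n)).
have h5 : eps / 2 * (Z m n * N k n) <= eps / 2 * (T n * T n) by rewrite ler_wpM2l// ltW.
have h6 : eps / 2 * (Z k n * T n) <= eps / 2 * (T n * T n) by rewrite ler_wpM2l// ltW.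
by lra.
Qed.

Lemma clique_share k : k \in ks -> (fun n => Z k n / T n) @ \oo --> d^-1.
Proof.
move=> kks.
have d3 : 3 <= d by have : (3%:R <= d) by [rewrite ler_nat].
apply/cvgrPdist_le => eps eps0.
have e2 : 0 < eps / 2 by lra.
have near1 : \forall n \near \oo, forall m, m \in ks ->
    Z k n - Z m n <= eps / 2 * T n /\ Z m n - Z k n <= eps / 2 * T n.
  suff gen (s : seq V) : {subset s <= ks} -> \forall n \near \oo, forall m, m \in s ->
     Z k n - Z m n <= eps / 2 * T n /\ Z m n - Z k n <= eps / 2 * T n by exact: gen.
  elim: s => [|m s IH] sks; first exact: nearW.
  have mks : m \in ks by apply: sks; exact: mem_head.
  have {}IH : \forall n \near \oo, forall m, m \in s ->
     Z k n - Z m n <= eps / 2 * T n /\ Z m n - Z k n <= eps / 2 * T n.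
    by apply: IH => i si; apply: sks; rewrite inE si orbT.
  move: (visits_cmp kks mks e2) (visits_cmp mks kks e2) IH.
  by apply: filterS3 => n h1 h2 h3 i; rewrite inE => /orP[/eqP ->//|/h3].
move: near1 (leaves_small e2); apply: filterS2 => n H L.
have T0 := total_gt0 n.
have sumT : T n = \sum_(m <- ks) Z m n + \sum_(l <- ls) Z l n by rewrite /total big_cat.
have L0 : 0 <= \sum_(l <- ls) Z l n by exact: sumr_ge0.
have sc c : \sum_(j <- ks) c = d * c.
  by rewrite big_const_seq count_predT iter_addr_0 mulr_natl.
have h1 : d * Z k n - \sum_(m <- ks) Z m n <= d * (eps / 2 * T n).
  rewrite -!sc -sumrB big_seq [leRHS]big_seq; apply: ler_sum => m /H[] //.
have h2 : \sum_(m <- ks) Z m n - d * Z k n <= d * (eps / 2 * T n).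
  rewrite -!sc -sumrB big_seq [leRHS]big_seq; apply: ler_sum => m /H[] //.
have d0 : 0 < d by lra.
have h3 : 3 * (eps / 2 * T n) <= d * (eps / 2 * T n).
  by rewrite ler_wpM2r// mulr_ge0 ?(ltW e2)// ltW.
have -> : d^-1 - Z k n / T n = (T n - d * Z k n) / (d * T n).
  move: (Z k n) (T n) T0 (d) d0 => z y /lt0r_neq0 y0 D /lt0r_neq0 D0.
  by field; apply/andP; split.
have dT : 0 < d * T n by rewrite mulr_gt0.
by rewrite ler_norml ler_pdivlMr// ler_pdivrMr//; apply/andP; split; lra.
Qed.

Lemma total_idn : (fun n => n%:R / T n) @ \oo --> (1 : R).
Proof.
have : (fun n => 1 - T 0 * (T n)^-1) @ \oo --> 1 - T 0 * 0.
  by apply: cvgB; [exact: cvg_cst|apply: cvgMr; exact: totalV_cvg].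
rewrite mulr0 subr0; apply: cvg_trans; apply: near_eq_cvg; apply: nearW => n.
have -> : n%:R = T n - T 0 by rewrite (totalE n); ring.
by rewrite mulrBl divff// lt0r_neq0.
Qed.

Lemma clique_visits_cvg k : k \in ks -> (fun n => Z k n / n%:R) @ \oo --> d^-1.
Proof.
move=> kks.
have inv : (fun n => (n%:R / T n)^-1) @ \oo --> (1^-1 : R).
  by apply: cvgV total_idn; rewrite oner_eq0.
have : (fun n => Z k n / T n * (n%:R / T n)^-1) @ \oo --> (d^-1 * 1^-1 : R).
  exact: cvgM (clique_share kks) inv.
rewrite invr1 mulr1; apply: cvg_trans; apply: near_eq_cvg; apply: nearW => n /=.
by rewrite invf_div mulrA divfK// lt0r_neq0.
Qed.

(** With S the sum of all A_i, ln T is equivalent to S - A_m for each m in the clique;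
    summing over m, d ln T is equivalent to (d - 1) S, hence A_m to
    S - ln T, that is to ln T / (d - 1). *)
Lemma ln_visits_leaf l : l \in ls ->
  asymp (fun n => ln (Z l n)) (fun n => (d - 1)^-1 * ln (T n)).
Proof.
move=> lls; set k := par l; have kks : k \in ks by exact: par_ks.
have d3 : 3 <= d by have : (3%:R <= d) by [rewrite ler_nat].
pose S n := \sum_(i <- ks) A i n.
have lnT m : m \in ks -> asymp (fun n => ln (T n)) (fun n => S n - A m n).
  move=> mks; apply: asymp_trans (ln_visits_clique mks).
  have d0 : 0 < d^-1 by rewrite invr_gt0; lra.
  have : (fun n => - ln (Z m n / T n)) @ \oo --> - ln d^-1.
    by apply: cvgN; apply: (continuous_cvg _ (continuous_ln d0)); exact: clique_share.
  move=> /cvgP cv; split; apply: eq_cvgn cv => n.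
  by rewrite ln_div ?posrE// opprB.
have sum1 : asymp (fun n => d * ln (T n)) (fun n => (d - 1) * S n).
  have := @asymp_sum R _ ks xpredT (fun _ n => ln (T n)) (fun m n => S n - A m n) (fun m mks _ => lnT m mks).
  move=> [h]; split; apply: eq_cvgn h => n.
  have sc c : \sum_(j <- ks) c = d * c.
    by rewrite big_const_seq count_predT iter_addr_0 mulr_natl.
  by rewrite sumrB !sc -/(S n); ring.
apply: asymp_trans (clock_law l) _.
have := asympB (asympZ (d - 1)^-1 (asymp_sym sum1)) (asymp_sym (lnT k kks)).
move=> [h]; split; apply: eq_cvgn h => n.
rewrite (sum_nbr_leaf _ lls) -/k; field.
by rewrite subr_eq0; apply/eqP; lra.
Qed.

Lemma leaf_visits_cvg l : l \in ls ->
  exists2 r : R, r != 0 & (fun n => n%:R `^ (- (d - 1)^-1) * Z l n) @ \oo --> r.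
Proof.
move=> lls; have [/cvg_ex[/= c hc]] := ln_visits_leaf lls.
have lnn : (fun n => ln (n%:R / T n)) @ \oo --> (0 : R).
  rewrite -ln1; apply: (continuous_cvg _ (continuous_ln ltr01)).
  exact: total_idn.
exists (expR (c - (d - 1)^-1 * 0)); first by rewrite lt0r_neq0// expR_gt0.
have : (fun n => expR (ln (Z l n) - (d - 1)^-1 * ln (T n) - (d - 1)^-1 * ln (n%:R / T n))) @ \oo
    --> expR (c - (d - 1)^-1 * 0).
  apply: (continuous_cvg _ (@continuous_expR R _)).
  by apply: cvgB => //; exact: cvgMr.
apply: cvg_trans; apply: near_eq_cvg; exists 1%N => // n /= n0.
have nR : 0 < n%:R :> R by rewrite ltr0n.
rewrite /powR (negbTE (lt0r_neq0 nR)) -[in RHS](@lnK _ (Z l n)) ?posrE// -expRD.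
by rewrite ln_div ?posrE//; congr expR; ring.
Qed.
End Trajectory.

(** * Upcrossings *)

Lemma bounded_oscillation {R : realType} (u : nat -> R) (B : R) :
  (forall n, 0 <= u n <= B) -> ~ cvgn u ->
  exists p q : rat, [/\ 0 < ratr p :> R, ratr p < ratr q :> R,
    (forall n, exists2 m, (n <= m)%N & u m <= ratr p) &
    (forall n, exists2 m, (n <= m)%N & ratr q <= u m)].
Proof.
move=> uB ncv.
have ub : has_ubound (range u) by exists B => _ [n _ <-]; have /andP[] := uB n.
have lb : has_lbound (range u) by exists 0 => _ [n _ <-]; have /andP[] := uB n.
have cs := cvg_sups_inf ub lb; have ci := cvg_infs_sup ub lb.
set L := inf _ in cs; set l := sup _ in ci.
have ui n : infs u n <= u n by apply: ge_inf; [exact: has_lbound_sdrop|exists n => /=].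
have us n : u n <= sups u n by apply: ub_le_sup; [exact: has_ubound_sdrop|exists n => /=].
have lL : l < L.
  rewrite lt_neqAle; apply/andP; split; last first.
    by apply: (ler_cvg_to ci cs); apply: nearW => n; apply: le_trans (us n).
  apply/eqP => e; apply: ncv; apply/cvg_ex; exists L.
  apply: squeeze_cvgr cs; last by rewrite -e; exact: ci.
  by apply: nearW => n; rewrite ui us.
have l0 : 0 <= l.
  apply: (@le_trans _ _ (infs u 0%N)).
    apply: lb_le_inf; first by exists (u 0%N), 0%N.
    by move=> _ [m _ <-]; have /andP[] := uB m.
  apply: ub_le_sup; last by exists 0%N.
  exists B => _ [n _ <-]; apply: (le_trans (ui n)); by have /andP[] := uB n.
have [p] := rat_in_itvoo lL; rewrite in_itv/= => /andP[lp pL].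
have [q] := rat_in_itvoo pL; rewrite in_itv/= => /andP[pq qL].
exists p, q; split => //; first exact: le_lt_trans lp.
- move=> n; have : infs u n < ratr p.
    apply: le_lt_trans lp; apply: ub_le_sup; last by exists n.
    exists B => _ [m _ <-]; apply: (le_trans (ui m)); by have /andP[] := uB m.
  move=> /inf_lt [|_ [m /= nm <-] /ltW um]; last by exists m.
  by exists (u n), n => /=.
- move=> n; have : ratr q < sups u n.
    apply: lt_le_trans qL _; apply: ge_inf; last by exists n.
    exists 0 => _ [m _ <-]; apply: (le_trans _ (us m)); by have /andP[] := uB m.
  move=> /sup_gt [|_ [m /= nm <-] /ltW um]; last by exists m.
  by exists (u n), n => /=.
Qed.

Section Upcrossings.
Context {R : realType}.
Variables (p q : R).
Hypotheses (p0 : 0 < p) (pq : p < q).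

(** The state of a machine counting the upcrossings of [p, q]: the number of those
    completed, and whether the sequence has gone below p since the last one. *)
Definition upcross (s : nat * bool) (y : R) : nat * bool :=
  if s.2 then (if q <= y then (s.1.+1, false) else s)
  else (if y <= p then (s.1, true) else s).

(** Dubins' potential: each completed upcrossing multiplies it by q / p, and during an
    upcrossing it is proportional to the sequence. *)
Definition upcross_potential (s : nat * bool) (y : R) : R :=
  (q / p) ^+ s.1 * (if s.2 then y / p else 1).

Lemma upcross_potential_ge0 s y : 0 <= y -> 0 <= upcross_potential s y.
Proof.
move=> y0; have q0 : 0 < q by exact: lt_trans pq.
apply: mulr_ge0; first by rewrite exprn_ge0// divr_ge0// ltW.
by case: ifP => // _; rewrite divr_ge0// ltW.
Qed.

(** The right-hand side is affine in y: this is what makes the potential of a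
    supermartingale a supermartingale. *)
Lemma upcross_potential_step s y : 0 <= y ->
  upcross_potential (upcross s y) y <= (q / p) ^+ s.1 * (if s.2 then y / p else 1).
Proof.
move=> y0; have q0 : 0 < q by exact: lt_trans pq.
have r0 : 0 <= q / p by rewrite divr_ge0// ltW.
rewrite /upcross_potential/upcross; case: s => c [] /=.
  case: ifP => //= qy; rewrite exprSr mulr1 ler_wpM2l ?exprn_ge0//.
  by rewrite ler_pM2r// invr_gt0.
case: ifP => //= yp; rewrite ler_wpM2l ?exprn_ge0//.
by rewrite ler_pdivrMr// mul1r.
Qed.

(** A sequence that is below p and above q infinitely often completes every number of
    upcrossings, and on completing the K-th one its potential equals (q / p)^K. *)
Lemma upcross_unbounded (u : nat -> R) (s : nat -> nat * bool) (B : R) :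
  s 0%N = upcross (0%N, false) (u 0%N) ->
  (forall n, s n.+1 = upcross (s n) (u n.+1)) ->
  (forall n, exists2 m, (n <= m)%N & u m <= p) ->
  (forall n, exists2 m, (n <= m)%N & q <= u m) ->
  ~ (forall n, upcross_potential (s n) (u n) <= B).
Proof.
move=> s0 sS lo hi bd.
have r1 : 1 < q / p by rewrite ltr_pdivlMr// mul1r.
have smono m n : (m <= n)%N -> ((s m).1 <= (s n).1)%N.
  elim: n => [|n IH]; first by rewrite leqn0 => /eqP ->.
  rewrite leq_eqVlt => /predU1P[->//|/IH]; move=> /leq_trans; apply.
  by rewrite sS /upcross; do 2 case: ifP => //= _.
have persist m n : (m <= n)%N -> (s m).2 -> (s n).1 = (s m).1 -> (s n).2.
  move=> /subnKC <-; elim: (n - m)%N => [|k IH]; first by rewrite addn0.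
  rewrite addnS => sm e.
  have ek : (s (m + k)%N).1 = (s m).1.
    apply/eqP; rewrite eqn_leq (smono _ _ (leq_addr k m)) andbT -e; exact: smono.
  have := IH sm ek; move: e; rewrite sS /upcross => + h; rewrite h -ek.
  by case: ifP => //= _ /eqP; rewrite eqn_leq ltnn.
have grow K : exists n, (K <= (s n).1)%N.
  elim: K => [|K [n Kn]]; first by exists 0%N.
  apply: contrapT => abs.
  have cst m : (n <= m)%N -> (s m).1 = K.
    move=> nm; apply/eqP; rewrite eqn_leq (leq_trans Kn (smono _ _ nm)) andbT.
    by rewrite leqNgt; apply/negP => Km; apply: abs; exists m.
  have [m nm um] := lo n.+1.
  case: m nm um => // m; rewrite ltnS => nm um.
  have up : (s m.+1).2.
    have uq : q <= u m.+1 = false by apply/negbTE; rewrite -ltNge; exact: le_lt_trans pq.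
    by rewrite sS /upcross um; case: ifP => [h|//]; rewrite uq h.
  have [k mk uk] := hi m.+2.
  case: k mk uk => // k; rewrite ltnS => mk uk.
  have upk : (s k).2.
    by apply: (persist m.+1) => //; rewrite !cst// ?leqW// (leq_trans _ mk)// leqW.
  have nk : (n <= k)%N by rewrite (leq_trans nm)// (leq_trans _ mk).
  have := cst k.+1; rewrite sS /upcross upk uk /= cst// leqW//.
  by move=> /(_ isT)/eqP; rewrite eqn_leq ltnn.
(* Bernoulli's inequality makes (q / p)^K unbounded. *)
have bernoulli K : 1 + K%:R * (q / p - 1) <= (q / p) ^+ K.
  elim: K => [|K IH]; first by rewrite mul0r addr0 expr0.
  have r0 : 0 <= q / p by lra.
  rewrite exprS; apply: le_trans (ler_wpM2l r0 IH).
  have := sqr_ge0 (q / p - 1); have : 0 <= K%:R :> R by [].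
  move=> /mulr_ge0/[apply]; rewrite -natr1 expr2; lra.
have B0 : 0 <= `|B| / (q / p - 1) by rewrite divr_ge0//; lra.
have := archi_boundP B0; set K := Num.bound _ => BK.
have rK : B < (q / p) ^+ K.
  apply: lt_le_trans (bernoulli K); rewrite ltr_pdivrMr in BK; last lra.
  by apply: (le_lt_trans (ler_norm B)); lra.
have K0 : (0 < K)%N by rewrite -(ltr_nat R); exact: le_lt_trans BK.
case: (ex_minnP (grow K)) => -[|n] Kn nmin.
  by move: Kn; rewrite s0 /upcross; case: ifP => _ /=; rewrite leqNgt K0.
have nK : ((s n).1 < K)%N by rewrite ltnNge; apply/negP => /nmin; rewrite ltnn.
have := bd n.+1; move: Kn; rewrite sS /upcross /upcross_potential.
case: ifP => _; case: ifP => _ //=; rewrite ?[(K <= _)%N]leqNgt ?nK// => Kn.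
have -> : (s n).1.+1 = K by apply/eqP; rewrite eqn_leq nK leqNgt Kn.
by rewrite mulr1 leNgt rK.
Qed.

End Upcrossings.

(** * Supermartingales on the tree of histories *)

Section Histories.
Context {dO : measure_display} {Omega : measurableType dO} {R : realType}.
Variables (P : probability Omega R) (V : choiceType) (G : graph V).
Variables (v0 : V) (a : V -> R) (X : nat -> Omega -> V) (vs : seq V).
Hypotheses (vs_uniq : uniq vs) (vs_full : forall v, v \in vs).
Hypothesis a_gt0 : forall i, 0 < a i.
Hypothesis X_VRRW : is_VRRW G P v0 a X.

(** The positions visited up to time n, the current one first. *)
Fixpoint history n (w : Omega) : seq V :=
  if n is m.+1 then X m.+1 w :: history m w else [:: X 0%N w].

Definition weight (h : seq V) v : R := a v + (count_mem v h)%:R.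

Definition weight_around (h : seq V) i := \sum_(k <- vs | G i k) weight h k.

Definition step (h : seq V) j : R :=
  if h is i :: _ then (G i j)%:R * (weight h j / weight_around h i) else 0.

Lemma weight_gt0 h v : 0 < weight h v.
Proof. by rewrite ltr_pwDl. Qed.

Lemma weight_ge0 h v : 0 <= weight h v.
Proof. exact: ltW (weight_gt0 h v). Qed.

Lemma weight_cons j h v : weight (j :: h) v = weight h v + (j == v)%:R.
Proof. by rewrite /weight /= natrD [(j == v)%:R + _]addrC addrA. Qed.

Lemma weight_around_ge0 h i : 0 <= weight_around h i.
Proof. by apply: sumr_ge0 => k _; exact: weight_ge0. Qed.

Lemma step_ge0 h j : 0 <= step h j.
Proof.
case: h => //= i h; rewrite mulr_ge0// divr_ge0 ?weight_ge0//.
exact: weight_around_ge0.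
Qed.

Lemma sum_step_le1 h : \sum_(j <- vs) step h j <= 1.
Proof.
case: h => [|i h] /=; first by rewrite big1.
rewrite (eq_bigr (fun j => (if G i j then weight (i :: h) j else 0) / weight_around (i :: h) i)).
  rewrite -mulr_suml -big_mkcond/= -/(weight_around _ _).
  have [->|n0] := eqVneq (weight_around (i :: h) i) 0; first by rewrite mul0r.
  by rewrite divff.
by move=> j _; case: ifP; rewrite ?mul1r ?mul0r.
Qed.

Lemma weight_history v n w : local_time a X v n w = weight (history n w) v.
Proof.
rewrite /local_time; elim: n => [|n IH].
  by rewrite big_nat1 /weight /= addn0.
by rewrite big_nat_recr//= addrA IH weight_cons.
Qed.

Lemma transition_history n j w : transition G a X n j w = step (history n w) j.
Proof.
have nbr i : [set` [seq k <- vs | G i k]] = neighbors G i.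
  by apply/seteqP; split => k /=; rewrite mem_filter vs_full andbT.
have -> : step (history n w) j = (G (X n w) j)%:R *
    (weight (history n w) j / weight_around (history n w) (X n w)).
  by case: n.
rewrite /transition weight_history; congr (_ * (_ / _)).
rewrite /weight_around -nbr -fsbig_seq ?filter_uniq// big_filter.
by apply: eq_bigr => k _; rewrite weight_history.
Qed.

Lemma measurable_X n (A : set V) : measurable (X n @^-1` A).
Proof. by case: X_VRRW. Qed.

Lemma measurable_history n (B : set (seq V)) :
  measurable [set w | B (history n w)].
Proof.
elim: n B => [|n IH] B; first exact: (measurable_X 0 [set v | B [:: v]]).
rewrite (_ : [set _ | _] = \big[setU/set0]_(j <- vs)
    (X n.+1 @^-1` [set j] `&` [set w | B (j :: history n w)])).
  apply: bigsetU_measurable => j _; apply: measurableI; first exact: measurable_X.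
  exact: (IH [set h | B (j :: h)]).
rewrite -bigcup_seq; apply/seteqP; split => [w /= Bw|w [j _ [/= <-]]//].
by exists (X n.+1 w); rewrite /= ?vs_full.
Qed.

Definition cylinder n h := [set w | history n w = h].

Lemma measurable_cylinder n h : measurable (cylinder n h).
Proof. exact: (measurable_history n [set h]). Qed.

Lemma filtration_mono n : natural_filtration X n `<=` natural_filtration X n.+1.
Proof.
apply: sub_sigma_algebra2 => _ [m mn [A _ <-]].
by exists m; [exact: leqW|exists A].
Qed.

Lemma filtration_cylinder n h : natural_filtration X n (cylinder n h).
Proof.
elim: n h => [|n IH] h.
  apply: sub_sigma_algebra; exists 0%N => //; exists [set v | [:: v] = h] => //.
have gen j : natural_filtration X n.+1 (X n.+1 @^-1` [set j]).
  by apply: sub_sigma_algebra; exists n.+1 => //=; exists [set j].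
case: h => [|j h].
  rewrite (_ : cylinder _ _ = set0); last by apply/seteqP; split.
  exact: sigma_algebra0.
rewrite (_ : cylinder _ _ = X n.+1 @^-1` [set j] `&` cylinder n h).
  apply: (@measurableI _ (g_sigma_algebraType _)); first exact: gen.
  exact: filtration_mono.
by rewrite /cylinder; apply/seteqP; split => w /= [-> ->].
Qed.

(** The transition probability is constant on a cylinder, so integrating it there gives
    the Markov property of the history. *)
Lemma prob_cylinder_cons n j h :
  (P (cylinder n.+1 (j :: h)) = (step h j)%:E * P (cylinder n h))%E.
Proof.
case: X_VRRW => _ _ /(_ n j)[_ _ /(_ _ (@filtration_cylinder n h))].
rewrite (_ : _ `&` _ = cylinder n.+1 (j :: h)); last first.
  by rewrite /cylinder; apply/seteqP; split => w /= [-> ->].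
move=> <-; rewrite (eq_integral (cst (step h j)%:E)).
  by rewrite integral_cst//; exact: measurable_cylinder.
by move=> w; rewrite inE => <-; rewrite transition_history.
Qed.

(** A finite inequality at each node of the tree, by which conditional expectations
    are avoided. *)
Definition supermartingale (S : seq V -> R) := forall h,
  0 <= S h /\ \sum_(j <- vs) step h j * S (j :: h) <= S h.

Definition reaches (S : seq V -> R) lam n N :=
  [set w | exists2 k, (k <= N)%N & lam <= S (history (n + k)%N w)].

Lemma measurable_reaches S lam n N : measurable (reaches S lam n N).
Proof.
rewrite (_ : reaches _ _ _ _ =
   \bigcup_(k in `I_N.+1) [set w | lam <= S (history (n + k)%N w)]).
  apply: fin_bigcup_measurable; first exact: finite_II.
  by move=> k _; exact: (measurable_history _ [set h | lam <= S h]).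
by apply/seteqP; split => w /= [k /= kN ?]; exists k.
Qed.

(** Induction on the horizon N: if S h has not reached lam, condition on the next
    position, apply the induction hypothesis to each of them, and use the
    supermartingale inequality at h. *)
Lemma ville_cylinder S lam n N h : supermartingale S -> 0 < lam ->
  (P (cylinder n h `&` reaches S lam n N) <= (S h / lam)%:E * P (cylinder n h))%E.
Proof.
move=> supS lam0; elim: N n h => [|N IH] n h;
  have mC := measurable_cylinder n h; have S0 := (supS h).1.
all: have [lamS|Slam] := leP lam (S h).
1,3: apply: (@le_trans _ _ (P (cylinder n h))).
1,3: by rewrite le_measure ?inE//; apply: measurableI => //; exact: measurable_reaches.
1,2: by rewrite -[leLHS]mul1e lee_wpmul2r// lee_fin ler_pdivlMr// mul1r.
- rewrite (_ : _ `&` _ = set0) ?measure0; last first.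
    apply/seteqP; split => // w [/= ch [k]]; rewrite leqn0 => /eqP ->.
    by rewrite addn0 ch leNgt Slam.
  by rewrite mule_ge0// lee_fin divr_ge0// ltW.
- have sub : cylinder n h `&` reaches S lam n N.+1 `<=`
      \bigcup_(j in [set` vs]) (cylinder n.+1 (j :: h) `&` reaches S lam n.+1 N).
    move=> w [/= ch [[|k]]]; first by rewrite addn0 ch leNgt Slam.
    rewrite ltnS => kN lamk; exists (X n.+1 w); first exact: vs_full.
    by split; [rewrite /cylinder /= ch|exists k => //; rewrite addSnnS].
  have boole : (P (cylinder n h `&` reaches S lam n N.+1) <=
      \sum_(j <- vs) P (cylinder n.+1 (j :: h) `&` reaches S lam n.+1 N))%E.
    rewrite fsbig_seq//; apply: content_sub_fsum => //.
    - by move=> j _; apply: measurableI; [exact: measurable_cylinder|exact: measurable_reaches].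
    - by apply: measurableI => //; exact: measurable_reaches.
  apply: (le_trans boole).
  apply: (@le_trans _ _ (\sum_(j <- vs) (step h j * S (j :: h) / lam)%:E * P (cylinder n h))%E).
    apply: lee_sum => j _; apply: (le_trans (IH _ _)).
    rewrite prob_cylinder_cons muleA -EFinM.
    by rewrite le_eqVlt; apply/orP; left; apply/eqP; congr (_%:E * _)%E; ring.
  rewrite -ge0_sume_distrl; last first.
    by move=> j _; rewrite lee_fin divr_ge0 ?mulr_ge0 ?step_ge0 ?(supS _).1// ltW.
  rewrite sumEFin lee_wpmul2r// lee_fin -mulr_suml ler_pM2r ?invr_gt0//.
  exact: (supS h).2.
Qed.

Lemma ville S lam N : supermartingale S -> 0 < lam ->
  (P (reaches S lam 0 N) <= ((\sum_(v <- vs) S [:: v]) / lam)%:E)%E.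
Proof.
move=> supS lam0.
have sub : reaches S lam 0 N `<=`
    \bigcup_(j in [set` vs]) (cylinder 0 [:: j] `&` reaches S lam 0 N).
  by move=> w hw; exists (X 0%N w); [exact: vs_full|split].
have boole : (P (reaches S lam 0 N) <=
    \sum_(j <- vs) P (cylinder 0 [:: j] `&` reaches S lam 0 N))%E.
  rewrite fsbig_seq//; apply: content_sub_fsum => //.
  - by move=> j _; apply: measurableI; [exact: measurable_cylinder|exact: measurable_reaches].
  - exact: measurable_reaches.
apply: (le_trans boole); rewrite mulr_suml -sumEFin; apply: lee_sum => j _.
apply: (le_trans (ville_cylinder _ _ _ supS lam0)).
have S0 := (supS [:: j]).1.
rewrite -[leRHS]mule1 lee_wpmul2l ?lee_fin ?divr_ge0 ?(ltW lam0)//.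
by rewrite probability_le1//; exact: measurable_cylinder.
Qed.

(** The event that S reaches L has probability O(1 / L). *)
Lemma supermartingale_bounded S : supermartingale S ->
  {ae P, forall w, exists B, forall n, S (history n w) <= B}.
Proof.
move=> supS; pose C := \sum_(v <- vs) S [:: v].
have C0 : 0 <= C by apply: sumr_ge0 => v _; exact: (supS _).1.
pose H (L : nat) := \bigcup_N reaches S L.+1%:R 0 N.
have mH L : measurable (H L) by apply: bigcup_measurable => N _; exact: measurable_reaches.
have PH L : (P (H L) <= (C / L.+1%:R)%:E)%E.
  have cv : P \o reaches S L.+1%:R 0 @ \oo --> P (H L).
    apply: nondecreasing_cvg_mu; [by move=> N; exact: measurable_reaches|exact: mH|].
    move=> M N MN; apply/subsetPset => w [k kM hk]; exists k => //.
    exact: leq_trans MN.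
  rewrite -(cvg_lim _ cv)//; apply: lime_le; first by apply/cvg_ex; eexists; exact: cv.
  by apply: nearW => N /=; apply: ville.
have mI : measurable (\bigcap_L H L) by exact: bigcap_measurable.
exists (\bigcap_L H L); split => //.
- apply/eqP; rewrite eq_le measure_ge0 andbT.
  apply/lee_addgt0Pr => e e0; rewrite add0e.
  have Ce : 0 <= C / e by rewrite divr_ge0// ltW.
  pose L := Num.bound (C / e).
  apply: (@le_trans _ _ (P (H L))).
    by rewrite le_measure ?inE//; exact: bigcap_inf.
  apply: (le_trans (PH L)); rewrite lee_fin ler_pdivrMr// mulrC -ler_pdivrMr//.
  apply: ltW; apply: (lt_le_trans (archi_boundP Ce)).
  by rewrite ler_nat.
- move=> w /= nb L _; apply: contrapT => nH; apply: nb.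
  exists L.+1%:R => n; rewrite leNgt; apply/negP => hn; apply: nH.
  by exists n => //; exists n => //; exact: ltW.
Qed.

(** ** Convergence of nonnegative supermartingales *)

Section SupermartingaleConvergence.
Variables (p q : R) (S : seq V -> R).

Fixpoint crossings (h : seq V) : nat * bool :=
  if h is j :: h' then upcross p q (crossings h') (S h) else (0%N, false).

Definition crossing_potential h := upcross_potential p q (crossings h) (S h).

Lemma crossing_potential_supermartingale : 0 < p -> p < q ->
  supermartingale S -> supermartingale crossing_potential.
Proof.
move=> p0 pq supS h; split; first exact: (upcross_potential_ge0 p0 pq _ (supS h).1).
pose c := (q / p) ^+ (crossings h).1.
have c0 : 0 <= c by rewrite exprn_ge0// divr_ge0// ltW// (lt_trans p0).
apply: (@le_trans _ _ (\sum_(j <- vs) step h j *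
    (c * (if (crossings h).2 then S (j :: h) / p else 1)))).
  apply: ler_sum => j _; rewrite ler_wpM2l ?step_ge0//.
  exact: (upcross_potential_step p0 pq _ (supS (j :: h)).1).
rewrite /crossing_potential /upcross_potential -/c.
case: ifP => _.
  rewrite (eq_bigr (fun j => step h j * S (j :: h) * (c / p))) => [|j _]; last by ring.
  rewrite -mulr_suml (_ : c * (S h / p) = S h * (c / p)); last by ring.
  by rewrite ler_wpM2r ?(supS h).2// divr_ge0// ltW.
by rewrite -mulr_suml mulr1 ler_piMl ?sum_step_le1.
Qed.

End SupermartingaleConvergence.

(** The upcrossing potentials of S for rational p < q are supermartingales, hence
    bounded, which excludes oscillation by [upcross_unbounded]. *)
Lemma supermartingale_cvg S : supermartingale S ->
  {ae P, forall w, cvgn (fun n => S (history n w))}.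
Proof.
move=> supS.
(* All pairs of rationals, enumerated so as to use countable additivity. *)
have /ae_foralln cr : forall k : nat, {ae P, forall w,
    if unpickle k is Some (p, q) then 0 < ratr p :> R -> ratr p < ratr q :> R ->
      exists B, forall n, crossing_potential (ratr p) (ratr q) S (history n w) <= B
    else True}.
  move=> k; case: unpickle => [[p q]|]; last exact: aeW.
  have [p0|np0] := pselect (0 < ratr p :> R); last by apply: aeW => w /np0.
  have [pq|npq] := pselect (ratr p < ratr q :> R); last by apply: aeW => w _ /npq.
  have := supermartingale_bounded (crossing_potential_supermartingale p0 pq supS).
  by apply: filterS => w.
move: cr (supermartingale_bounded supS); apply: filterS2 => w cr [B hB].
apply: contrapT => ncv.
have uB n : 0 <= S (history n w) <= B by rewrite (supS _).1 hB.
have [p [q [p0 pq lo hi]]] := bounded_oscillation uB ncv.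
have := cr (pickle (p, q)); rewrite pickleK => /(_ p0 pq)[K hK].
exact: (upcross_unbounded p0 pq (s := fun n => crossings (ratr p) (ratr q) S (history n w)) _ _ lo hi hK).
Qed.

(** * The supermartingales of the walk *)

Definition increment (h : seq V) v : R :=
  if h is i :: _ then (G i v)%:R / weight_around h i else 0.

Fixpoint history_clock v (h : seq V) : R :=
  if h is _ :: h' then history_clock v h' + increment h' v else 0.

(** The clock is restarted at the first visit to v, because [weight h v - 1], by which
    the exponential of the clock is to be divided, may be negative earlier. *)
Fixpoint clock_since_visit v (h : seq V) : R :=
  if h is _ :: h' then
    if v \in h' then clock_since_visit v h' + increment h' v else 0
  else 0.

Lemma stepE h v : step h v = weight h v * increment h v.
Proof. by case: h => [|i h] /=; [rewrite mulr0|ring]. Qed.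

Lemma sum_step_two h v x y : 0 <= x ->
  \sum_(j <- vs) step h j * (if j == v then y else x) <=
  (1 - step h v) * x + step h v * y.
Proof.
move=> x0; rewrite (bigD1_seq v)//= eqxx addrC lerD2r.
rewrite (eq_bigr (fun j => step h j * x)) => [|j /negbTE ->//].
rewrite -mulr_suml ler_wpM2r// lerBrDl.
by have := sum_step_le1 h; rewrite (bigD1_seq v).
Qed.

Lemma one_sub_expR (x : R) : (1 - x) * expR x <= 1.
Proof.
have := expR_ge1Dx (- x); rewrite -(ler_pM2r (expR_gt0 x)) -expRD addNr expR0.
by [].
Qed.

Definition growth v h := weight h v * expR (- history_clock v h).

(** One step multiplies the expectation of the local time by 1 + increment, which is at
    most the exponential of the increment. *)
Lemma growth_supermartingale v : supermartingale (growth v).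
Proof.
move=> h; split; first by rewrite mulr_ge0 ?weight_ge0 ?expR_ge0.
pose e := expR (- history_clock v h - increment h v).
rewrite (eq_bigr (fun j => step h j *
   (if j == v then (weight h v + 1) * e else weight h v * e))); last first.
  move=> j _; rewrite /growth weight_cons /= opprD -/e.
  by case: eqP => _ //=; rewrite addr0.
have e0 : 0 <= e by exact: expR_ge0.
apply: (le_trans (sum_step_two _ _ _ _)); first by rewrite mulr_ge0 ?weight_ge0.
rewrite stepE /growth.
have -> : (1 - weight h v * increment h v) * (weight h v * e) +
   weight h v * increment h v * ((weight h v + 1) * e) =
   weight h v * ((1 + increment h v) * e) by ring.
rewrite ler_wpM2l ?weight_ge0// /e expRD mulrCA ler_piMr ?expR_ge0//.
by have := one_sub_expR (- increment h v); rewrite opprK.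
Qed.

(** At the first visit the local time becomes a v + 1 and the restarted clock is 0, so
    the value (a v)^-1 is kept. *)
Definition inverse_growth v h : R :=
  if v \in h then expR (clock_since_visit v h) / (weight h v - 1) else (a v)^-1.

Lemma weight_visited v h : v \in h -> a v <= weight h v - 1.
Proof.
rewrite -has_pred1 has_count => c0.
by rewrite /weight -addrA lerDl subr_ge0 ler1n.
Qed.

(** With the shift by 1 the expected factor is exactly 1 - increment: for a jump
    probability p = z * increment, where z is the local time,
    (1 - p) / (z - 1) + p / z = (1 - increment) / (z - 1). *)
Lemma inverse_growth_supermartingale v : supermartingale (inverse_growth v).
Proof.
move=> h; split.
  rewrite /inverse_growth; case: ifP => [/weight_visited h1|_]; last by rewrite invr_ge0 ltW.
  by rewrite divr_ge0 ?expR_ge0// (le_trans _ h1)// ltW.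
rewrite /inverse_growth; case vh : (v \in h).
  have w1 : 0 < weight h v - 1 := lt_le_trans (a_gt0 v) (weight_visited vh).
  pose e := expR (clock_since_visit v h + increment h v).
  rewrite (eq_bigr (fun j => step h j *
     (if j == v then e / weight h v else e / (weight h v - 1)))); last first.
    move=> j _; rewrite inE vh orbT weight_cons /= vh -/e.
    by case: eqP => _ //=; rewrite ?addrK ?addr0.
  have e0 : 0 <= e by exact: expR_ge0.
  apply: (le_trans (sum_step_two _ _ _ _)); first by rewrite divr_ge0// ltW.
  rewrite stepE.
  have -> : (1 - weight h v * increment h v) * (e / (weight h v - 1)) +
     weight h v * increment h v * (e / weight h v) =
     (1 - increment h v) * e / (weight h v - 1).
    move: w1 (weight_gt0 h v); move: (weight h v) => z z1 z0.
    by field; rewrite !lt0r_neq0.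
  rewrite ler_pM2r ?invr_gt0// /e expRD mulrCA ler_piMr ?expR_ge0//.
  exact: one_sub_expR.
rewrite (eq_bigr (fun j => step h j * (a v)^-1)); last first.
  move=> j _; rewrite inE vh orbF /= vh; case: eqP => // <-.
  have : count_mem v h = 0%N by apply/count_memPn; rewrite vh.
  by rewrite weight_cons /weight eqxx => ->; rewrite addr0 addrK expR0 mul1r.
by rewrite -mulr_suml ler_piMl ?sum_step_le1// invr_ge0 ltW.
Qed.

(** Bounds the clock when v is never visited. *)
Definition unvisited_potential v h : R :=
  if v \in h then 0 else expR (a v * history_clock v h).

Lemma unvisited_potential_supermartingale v : supermartingale (unvisited_potential v).
Proof.
move=> h; split.
  by rewrite /unvisited_potential; case: ifP => // _; exact: expR_ge0.
rewrite /unvisited_potential; case vh : (v \in h).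
  by rewrite big1// => j _; rewrite inE vh orbT mulr0.
pose e := expR (a v * (history_clock v h + increment h v)).
rewrite (eq_bigr (fun j => step h j * (if j == v then 0 else e))); last first.
  by move=> j _; rewrite inE vh orbF eq_sym /=.
apply: (le_trans (sum_step_two _ _ _ _)); first exact: expR_ge0.
have wa : weight h v = a v.
  have : count_mem v h = 0%N by apply/count_memPn; rewrite vh.
  by rewrite /weight => ->; rewrite addr0.
rewrite stepE wa mulr0 addr0 /e mulrDr expRD mulrCA ler_piMr ?expR_ge0//.
exact: one_sub_expR.
Qed.

(** The growth converges by [supermartingale_cvg].  Its limit is positive: after a visit
    to v because the inverse growth is bounded, and if v is never visited
    because the clock itself is bounded. *)
Lemma history_clock_law v :
  {ae P, forall w, cvgn (fun n => ln (weight (history n w) v) - history_clock v (history n w))}.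
Proof.
move: (supermartingale_cvg (growth_supermartingale v))
  (supermartingale_bounded (inverse_growth_supermartingale v))
  (supermartingale_bounded (unvisited_potential_supermartingale v)).
apply: filterS3 => w cW [B hB] [C hC].
pose H n := history n w.
have [e e0 [n0 hn0]] : exists2 e, 0 < e & exists n0, forall n, (n0 <= n)%N -> e <= growth v (H n).
  have [[n0 vn0]|nv] := pselect (exists n0, v \in H n0); last first.
    have vn n : (v \in H n) = false by apply/negP => vn; apply: nv; exists n.
    exists (a v * expR (- (C / a v))); first by rewrite mulr_gt0 ?expR_gt0.
    exists 0%N => n _; have := hC n; rewrite /unvisited_potential -/(H n) vn => h.
    have : a v * history_clock v (H n) <= C.
      by apply: le_trans h; apply: le_trans (expR_ge1Dx _); rewrite lerDr.
    rewrite mulrC -ler_pdivlMr// => h1; apply: ler_pM; rewrite ?expR_ge0 ?(ltW (a_gt0 v))//.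
      by rewrite lerDl.
    by rewrite ler_expR lerN2.
  pose c := history_clock v (H n0) - clock_since_visit v (H n0).
  have cc n : (n0 <= n)%N -> v \in H n /\ clock_since_visit v (H n) = history_clock v (H n) - c.
    move=> /subnKC <-; elim: (n - n0)%N => [|k [vk IH]].
      by rewrite addn0; split => //; rewrite /c; ring.
    by rewrite addnS /H /= -/(H _) inE vk orbT IH; split => //; ring.
  have B0 : 0 < B.
    apply: lt_le_trans (hB n0); rewrite /inverse_growth -/(H n0) vn0.
    by rewrite divr_gt0 ?expR_gt0// (lt_le_trans (a_gt0 v))// weight_visited.
  exists (expR (- c) / B); first by rewrite divr_gt0 ?expR_gt0.
  exists n0 => n /cc[vn cn]; have := hB n; rewrite /inverse_growth -/(H n) vn cn.
  have w1 : 0 < weight (H n) v - 1 := lt_le_trans (a_gt0 v) (weight_visited vn).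
  rewrite ler_pdivrMr// expRD => h; rewrite ler_pdivrMr// /growth.
  have E := expR_gt0 (history_clock v (H n)).
  rewrite [in leRHS]expRN mulrAC ler_pdivlMr// mulrC.
  have : expR (history_clock v (H n)) * expR (- c) <= B * weight (H n) v.
    by apply: (le_trans h); rewrite ler_pM2l//; lra.
  by rewrite [B * _]mulrC.
have /cvg_ex[/= l hl] := cW.
have el : e <= l.
  apply: (ler_cvg_to (cvg_cst e) hl); exists n0 => // n /= n0n; exact: hn0.
have l0 : 0 < l := lt_le_trans e0 el.
have : (fun n => ln (growth v (H n))) @ \oo --> ln l.
  by apply: (continuous_cvg _ (continuous_ln l0)).
move=> /cvgP; apply: eq_cvgn => n.
by rewrite /growth lnM ?posrE ?weight_gt0 ?expR_gt0// expRK.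
Qed.

(** A history with a step that does not follow an edge: its indicator is a
    supermartingale started at 0, so that such steps almost surely do not occur. *)
Fixpoint has_jump (h : seq V) : bool :=
  if h is j :: h' then has_jump h' || (if h' is i :: _ then ~~ G i j else false)
  else false.

Lemma has_jump_supermartingale : supermartingale (fun h => (has_jump h)%:R).
Proof.
move=> h; split => //; case jh : (has_jump h) => /=.
  rewrite (eq_bigr (fun j => step h j)) ?sum_step_le1// => j _.
  by rewrite jh mulr1.
rewrite big1// => j _; rewrite jh; case: h {jh} => [|i h] /=; first by rewrite mulr0.
by case: (G i j); rewrite /= ?mulr0// mul0r mul0r.
Qed.

Lemma history_adjacent : {ae P, forall w, forall n, G (X n w) (X n.+1 w)}.
Proof.
have /ae_foralln h : forall N, {ae P, forall w,
    ~ reaches (fun h => (has_jump h)%:R) 1 0 N w}.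
  move=> N; exists (reaches (fun h => (has_jump h)%:R) 1 0 N); split.
  - exact: measurable_reaches.
  - apply/eqP; rewrite eq_le measure_ge0 andbT.
    apply: (le_trans (ville N has_jump_supermartingale ltr01)).
    by rewrite big1// mul0r.
  - by move=> w /contrapT.
move: h; apply: filterS => w h n; apply: contrapT => /negP nG.
apply: (h n.+1); exists n.+1 => //; rewrite add0n /=.
by case: n nG {h} => [|n] /= ->; rewrite ?orbT.
Qed.

Lemma history_clockE (ks ls : seq V) v w : vs = ks ++ ls ->
  (fun n => history_clock v (history n w)) =1
  (fun n => \sum_(i <- ks ++ ls | G v i) clock G ks ls a (X^~ w) i n).
Proof.
move=> vsE n; rewrite /clock /series /= exchange_big/=.
elim: n => [|n IH]; first by rewrite big_geq //= addr0.
rewrite big_nat_recr//= -IH /=; congr (_ + _).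
have aroundE i t : around G ks ls a (X^~ w) i t = weight_around (history t w) i.
  by rewrite /around -vsE; apply: eq_bigr => j _; exact: weight_history.
transitivity (\sum_(i <- vs | G v i) (X n w == i)%:R / weight_around (history n w) (X n w)).
  rewrite -mulr_suml vsE sum_indicator -?vsE// adj_sym.
  by case: n {IH}.
rewrite -vsE; apply: eq_bigr => i _; rewrite aroundE.
by case: eqP => [->//|]; rewrite !mul0r.
Qed.

End Histories.

(** * Almost sure asymptotics on complete-like graphs *)

Theorem corollary1p3 (R : realType) (dO : measure_display)
    (Omega : measurableType dO) (P : probability Omega R)
    (V : choiceType) (G : graph V) (d : nat) (S : set V)
    (G_locfin : locally_finite G) (G_conn : connected_graph G)
    (G_complete_like : complete_like G d S)
    (v0 : V) (a : V -> R) (a_gt0 : forall i, 0 < a i)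
    (X : nat -> Omega -> V) (X_VRRW : is_VRRW G P v0 a X) :
  {ae P, forall w,
    (forall i, S i ->
      (fun n : nat => local_time a X i n w / n%:R) @ \oo --> (d%:R^-1 : R)) /\
    (forall j, boundary G S j ->
      exists2 l : R, l != 0 &
        (fun n : nat =>
          n%:R `^ (- (d%:R - 1)^-1) * local_time a X j n w) @ \oo --> l)}.
Proof.
have [d3 Sd Sadj SV leafP] := G_complete_like.
have Sfin : finite_set S by apply/finite_setP; exists d.
have Bfin : finite_set (boundary G S).
  apply: (@sub_finite_set _ _ (\bigcup_(i in S) neighbors G i)).
    by move=> j [_ [i Si Gij]]; exists i.
  by apply: bigcup_finite => // i _; exact: G_locfin.
pose ks : seq V := finmap.enum_fset (fset_set S).
pose ls : seq V := finmap.enum_fset (fset_set (boundary G S)).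
have ksP i : (i \in ks) = (i \in S) by rewrite /ks in_fset_set.
have lsP i : (i \in ls) = (i \in boundary G S) by rewrite /ls in_fset_set.
have size_ks : size ks = d by exact: card_fset_set.
have vs_uniq : uniq (ks ++ ls).
  rewrite cat_uniq !finmap.fset_uniq andbT /=; apply/hasPn => l.
  by rewrite lsP inE => -[nSl _]; rewrite ksP notin_setE.
have vs_full v : v \in ks ++ ls.
  rewrite mem_cat ksP lsP -in_setU SV; exact: in_setT.
have /choice[par parP] l : exists k, l \in ls -> S k /\ neighbors G l = [set k].
  have [lls|] := boolP (l \in ls); last by exists l.
  by move: lls; rewrite lsP inE => /leafP[k Sk kE]; exists k.
have ks_adj : {in ks &, forall i j, G i j = (i != j)}.
  move=> i j; rewrite !ksP !inE => Si Sj.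
  by have [->|ij] := eqVneq i j; [rewrite adj_irr|exact: Sadj].
have par_ks : {in ls, forall l, par l \in ks}.
  by move=> l /parP[Sk _]; rewrite ksP inE.
have ls_adj : {in ls, forall l j, G l j = (j == par l)}.
  move=> l /parP[_ lE] j; apply/idP/eqP => [Glj|->].
    by have : neighbors G l j by []; rewrite lE.
  by have : neighbors G l (par l) by rewrite lE.
have d3' : (3 <= size ks)%N by rewrite size_ks.
have law : {ae P, forall w, forall v,
    cvgn (fun n => ln (weight a (history X n w) v) -
      history_clock G a (ks ++ ls) v (history X n w))}.
  suff gen (s : seq V) : {ae P, forall w, forall v, v \in s ->
      cvgn (fun n => ln (weight a (history X n w) v) -
        history_clock G a (ks ++ ls) v (history X n w))}.
    by have := gen (ks ++ ls); apply: filterS => w h v; exact: h.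
  elim: s => [|u s IH]; first exact: aeW.
  move: (history_clock_law vs_uniq vs_full a_gt0 X_VRRW u) IH.
  by apply: filterS2 => w hu hs v; rewrite inE => /predU1P[->//|/hs].
move: law (history_adjacent vs_uniq vs_full a_gt0 X_VRRW).
apply: filterS2 => w law adj.
have clock_law v : asymp (fun n => ln (visits a (X^~ w) v n))
    (fun n => \sum_(i <- ks ++ ls | G v i) clock G ks ls a (X^~ w) i n).
  split; apply: eq_cvgn (law v) => n.
  by rewrite -weight_history (history_clockE G a X vs_uniq vs_full v w erefl).
split => [i Si|j Bj]; rewrite -size_ks.
  by apply: (clique_visits_cvg vs_uniq vs_full ks_adj par_ks ls_adj) => //; rewrite ksP inE.
by apply: (leaf_visits_cvg vs_uniq vs_full ks_adj par_ks ls_adj) => //; rewrite lsP inE.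
Qed.
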